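(* Assume that the mobility is a constant of order $\mathcal{O}(\epsilon^2)$, namely $m_\epsilon=m\epsilon^2$ with a constant $m>0$ independent of $\epsilon$. Then the formal asymptotic limit, as $\epsilon\to 0$, of the diffuse interface system (D) given in the context is the sharp interface model (S) given below. That is: let $(\phi_\epsilon,\mu_\epsilon,\mathbf{u}_\epsilon,p_\epsilon,\mathbf{B}_\epsilon,\mathbf{E}_\epsilon,\mathbf{J}_\epsilon)$ be a family of solutions of (D) that admits formally matched outer and inner expansions in the sense described in the context, with interface $\Gamma(t)$ and bulk regions $\Omega_\pm(t)$. Then the leading order outer fields $(\mathbf{u},p,\mathbf{B},\mathbf{E},\mathbf{J}):=(\mathbf{u}_0^\pm,p_0^\pm,\mathbf{B}_0^\pm,\mathbf{E}_0^\pm,\mathbf{J}_0^\pm)$ in $\Omega_\pm(t)$ satisfy in $\Omega_\pm(t)$: $$\rho_\pm(\partial_t\mathbf{u}+\mathbf{u}\cdot\nabla\mathbf{u})=\nabla\cdot\big(2\eta_\pm\mathbb{D}(\mathbf{u})-p\mathbb{I}\big)+\mathbf{J}\times\mathbf{B}+\rho_\pm\mathbf{g},\qquad \nabla\cdot\mathbf{u}=0,$$ $$\partial_t\mathbf{B}+\nabla\times\mathbf{E}=\mathbf{0},\qquad \nabla\times\mathbf{B}=\mu_0\mathbf{J},\qquad \mathbf{J}=\sigma_\pm(\mathbf{E}+\mathbf{u}\times\mathbf{B}),\qquad \nabla\cdot\mathbf{B}=0,\qquad \nabla\cdot\mathbf{J}=0;$$ and on $\Gamma(t)$: $$[2\eta\mathbb{D}(\mathbf{u})-p\mathbb{I}]\,\mathbf{n}_\Gamma=-\lambda\kappa\,\mathbf{n}_\Gamma,\qquad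 [\mathbf{u}]=\mathbf{0},\qquad [\mathbf{B}]=\mathbf{0},$$ $$\mathbf{n}_\Gamma\times[\mathbf{E}]=\mathbf{0},\qquad [\mathbf{J}]\cdot\mathbf{n}_\Gamma=0,\qquad V_\Gamma=\mathbf{u}\cdot\mathbf{n}_\Gamma.$$ These equations constitute model (S). Here $[\chi]=\chi_+-\chi_-$ is the jump across $\Gamma(t)$ of the traces from $\Omega_+(t)$ and $\Omega_-(t)$, and $\eta=\eta_\pm$ in $\Omega_\pm(t)$.
   Context: **Setting.** $\Omega\subset\mathbb{R}^3$ is a fixed bounded domain. $\rho_\pm,\eta_\pm,\sigma_\pm,\mu_0,\lambda$ are positive constants (densities, viscosities, conductivities of two fluids; permeability of free space; surface tension coefficient), and $\widehat{\lambda}=\frac{3}{2\sqrt2}\lambda$. $\mathbf{g}=(0,0,-g)^\top$ with a constant $g>0$. $\mathbb{D}(\mathbf{u})=\frac12(\nabla\mathbf{u}+(\nabla\mathbf{u})^\top)$, and $\mathbb{I}$ is the identity tensor. For $\chi\in\{\rho,\eta,\sigma\}$, $\chi(\phi)=\frac{\chi_+-\chi_-}{2}\phi+\frac{\chi_++\chi_-}{2}$, and $\rho_d=\frac{\rho_+-\rho_-}{2}$. **Diffuse interface system (D).** For $\epsilon>0$ the unknowns are the order parameter $\phi$, chemical potential $\mu$, velocity $\mathbf{u}$, pressure $p$, magnetic field $\mathbf{B}$, electric field $\mathbf{E}$ and current density $\mathbf{J}$, satisfying in $\Omega$ $$\partial_t\phi+\nabla\cdot(\phi\mathbf{u})=\nabla\cdot(m_\epsilon\nabla\mu),\qquad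 \mu=-\widehat\lambda\epsilon\Delta\phi+\widehat\lambda\epsilon^{-1}(\phi^3-\phi),$$ $$\rho(\phi)\partial_t\mathbf{u}+\big(\rho(\phi)\mathbf{u}-\rho_dm_\epsilon\nabla\mu\big)\cdot\nabla\mathbf{u}=\nabla\cdot\big(2\eta(\phi)\mathbb{D}(\mathbf{u})-p\mathbb{I}\big)+\mu\nabla\phi+\mathbf{J}\times\mathbf{B}+\rho(\phi)\mathbf{g},\qquad \nabla\cdot\mathbf{u}=0,$$ $$\partial_t\mathbf{B}+\nabla\times\mathbf{E}=\mathbf{0},\quad \nabla\times\mathbf{B}=\mu_0\mathbf{J},\quad \mathbf{J}=\sigma(\phi)(\mathbf{E}+\mathbf{u}\times\mathbf{B}),\quad \nabla\cdot\mathbf{B}=0,\quad \nabla\cdot\mathbf{J}=0.$$ **Formal asymptotic limit (matched asymptotic expansions).** The following is assumed of the family of solutions. (i) *Geometry.* $\Omega_+(t)=\{\phi_\epsilon>0\}$, $\Omega_-(t)=\{\phi_\epsilon<0\}$, $\Gamma(t)=\{\phi_\epsilon=0\}$. In the formal expansion $\Gamma(t)$ is treated as a smooth evolving surface not in contact with $\partial\Omega$, separating $\Omega_+(t)$ and $\Omega_-(t)$, and not itself expanded in $\epsilon$. $d$ is the signed distance function to $\Gamma(t)$, with $d>0$ in $\Omega_+(t)$; $\mathbf{n}_\Gamma=\nabla d$ is the unit normal (pointing into $\Omega_+(t)$), $V_\Gamma=-\partial_td$ is the normal velocity, and $\kappa=-\Delta d$ on $\Gamma(t)$ is the mean curvature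 (sum of principal curvatures with this sign). (ii) *Outer expansions.* Away from $\Gamma(t)$, in $\Omega_\pm(t)$, each of $\phi_\epsilon,\mathbf{u}_\epsilon,p_\epsilon,\mathbf{B}_\epsilon,\mathbf{E}_\epsilon,\mathbf{J}_\epsilon$ has an expansion $\chi_\epsilon=\chi_0^\pm+\epsilon\chi_1^\pm+\epsilon^2\chi_2^\pm+\cdots$ with smooth coefficients, and $\mu_\epsilon=\epsilon^{-1}\mu_0^\pm+\mu_1^\pm+\epsilon\mu_2^\pm+\cdots$, where $\mu_0^\pm=\widehat\lambda((\phi_0^\pm)^3-\phi_0^\pm)$. Consistently with (i), $\phi_0^+>0$ and $\phi_0^-<0$. (iii) *Inner expansions.* Near $\Gamma(t)$, with the stretched variable $z=d/\epsilon$, the same fields are expanded as $\chi_\epsilon=\chi_0^i+\epsilon\chi_1^i+\epsilon^2\chi_2^i+\cdots$, with coefficients depending smoothly on $z\in\mathbb{R}$, on the position along $\Gamma(t)$, and on $t$; and $\mu_\epsilon=\epsilon^{-1}\mu_0^i+\mu_1^i+\epsilon\mu_2^i+\cdots$, where $\mu_0^i=\widehat\lambda(-\partial_{zz}\phi_0^i+(\phi_0^i)^3-\phi_0^i)$ and $\mu_1^i=\widehat\lambda(-\partial_{zz}\phi_1^i+\kappa\partial_z\phi_0^i+(3(\phi_0^i)^2-1)\phi_1^i)$. Derivatives of inner quantities are computed by $$\partial_t\chi=-\epsilon^{-1}V_\Gamma\partial_z\chi+\mathcal{O}(1),\quad \nabla\chi=\epsilon^{-1}\partial_z\chi\,\mathbf{n}_\Gamma+\nabla_\Gamma\chi+\mathcal{O}(\epsilon),$$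 $$\nabla\cdot\boldsymbol{\chi}=\epsilon^{-1}\partial_z\boldsymbol{\chi}\cdot\mathbf{n}_\Gamma+\nabla_\Gamma\cdot\boldsymbol{\chi}+\mathcal{O}(\epsilon),\quad \Delta\chi=\epsilon^{-2}\partial_{zz}\chi-\epsilon^{-1}\kappa\partial_z\chi+\mathcal{O}(1),$$ where $\nabla_\Gamma$ is the surface gradient (and $\nabla_\Gamma\cdot$ the surface divergence); vector gradients and curls are treated correspondingly. (iv) *Matching conditions.* For each variable $\chi$ (including $\mu$ with its shifted expansion), at every point of $\Gamma(t)$, $$\lim_{z\to\pm\infty}\chi_0^i=\chi_0^\pm,\qquad \lim_{z\to\pm\infty}\partial_z\chi_0^i=0,\qquad \lim_{z\to\pm\infty}\partial_z\chi_1^i=\nabla\chi_0^\pm\cdot\mathbf{n}_\Gamma,$$ where the right-hand sides are traces on $\Gamma(t)$ from $\Omega_\pm(t)$. (v) *Formal substitution.* Inserting the outer (respectively inner) expansions into (D) and collecting powers of $\epsilon$, the resulting identities hold at each order; limits as $z\to\pm\infty$ and integrations (by parts) over $z\in\mathbb{R}$ are permitted formally. ''The formal asymptotic limit of (D) is (S)'' means that the leading order outer fields of any such family satisfy (S). *)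

(* Defs.v *)
From mathcomp Require Import all_boot all_order all_algebra.
From mathcomp Require Import all_classical all_reals all_analysis.

Set Implicit Arguments.
Unset Strict Implicit.
Unset Printing Implicit Defensive.

Import Order.TTheory GRing.Theory Num.Theory.
Import numFieldNormedType.Exports.

Local Open Scope classical_set_scope.
Local Open Scope ring_scope.

Record constants (R : realType) := Constants {
  rho_ : bool -> R;  (* [true] is the phase +, [false] the phase - *)
  eta_ : bool -> R;
  sigma_ : bool -> R;
  mu0 : R;
  lambda : R;
  grav : R;
  mob : R  (* the mobility is [mob * eps ^ 2] *)
}.

Definition constants_pos (R : realType) (k : constants R) : Prop :=
  [/\ forall s, 0 < rho_ k s, forall s, 0 < eta_ k s,
      forall s, 0 < sigma_ k s &
      [/\ 0 < mu0 k, 0 < lambda k, 0 < grav k & 0 < mob k]].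

Definition hat_lambda (R : realType) (k : constants R) : R :=
  3 / (2 * Num.sqrt 2) * lambda k.

Inductive component :=
| Phi | Mu | Vel of 'I_3 | Prs | Mag of 'I_3 | Ele of 'I_3 | Cur of 'I_3.

(* The equations are written once, over a bare signature without laws, and are
    interpreted in three calculi: smooth functions, formal outer series and
    formal inner series.  "Inserting an expansion and collecting powers of eps"
    is the interpretation in a calculus of formal series, whose equality [eqv]
    is the equality of all coefficients. *)

Record calculus (R : realType) := Calculus {
  elt :> Type;
  add : elt -> elt -> elt;
  opp : elt -> elt;
  mul : elt -> elt -> elt;
  cst : R -> elt;
  eps : elt;
  epsV : elt;              (* the inverse of eps *)
  dt : elt -> elt;
  dx : 'I_3 -> elt -> elt;
  lap : elt -> elt;
  eqv : elt -> elt -> Prop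
}.
Arguments add {R c}. Arguments opp {R c}. Arguments mul {R c}.
Arguments cst {R} c. Arguments eps {R} c. Arguments epsV {R} c.
Arguments dt {R c}. Arguments dx {R c}. Arguments lap {R c}.
Arguments eqv {R c}.

Declare Scope calculus_scope.
Delimit Scope calculus_scope with calc.
Notation "x + y" := (add x y) : calculus_scope.
Notation "- x" := (opp x) : calculus_scope.
Notation "x - y" := (add x (opp y)) : calculus_scope.
Notation "x * y" := (mul x y) : calculus_scope.
Notation "x =~ y" := (eqv x y) (at level 70) : calculus_scope.

Section VectorCalculus.
Context (R : realType) (C : calculus R).
Local Open Scope calculus_scope.
Implicit Types (f p e : C) (a b v u : 'I_3 -> C) (T : 'I_3 -> 'I_3 -> C).

Definition sum3 v : C := \big[add/cst C 0%R]_(i < 3) v i.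

Definition dot a b : C := sum3 (fun i => a i * b i).

(* [ordS] is the cyclic successor on the indices 0, 1, 2. *)
Definition cross a b (i : 'I_3) : C :=
  a (ordS i) * b (ordS (ordS i)) - a (ordS (ordS i)) * b (ordS i).

Definition div v : C := sum3 (fun i => dx i (v i)).

Definition curl v (i : 'I_3) : C :=
  dx (ordS i) (v (ordS (ordS i))) - dx (ordS (ordS i)) (v (ordS i)).

(* a . grad v *)
Definition advect a v (i : 'I_3) : C := dot a (fun j => dx j (v i)).

Definition divT T (i : 'I_3) : C := sum3 (fun j => dx j (T i j)).

Definition strain u (i j : 'I_3) : C :=
  cst C (2^-1)%R * (dx j (u i) + dx i (u j)).

(* 2 e D(u) - p I, for a viscosity [e] *)
Definition stress e u p (i j : 'I_3) : C :=
  (cst C 2%R * e) * strain u i j - cst C ((i == j)%:R)%R * p.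

(* [c true] at phi = 1 and [c false] at phi = -1 *)
Definition mix (c : bool -> R) f : C :=
  cst C ((c true - c false) / 2)%R * f + cst C ((c true + c false) / 2)%R.

Definition gravity (g : R) (i : 'I_3) : C :=
  cst C (if i == ord_max then - g else 0)%R.

End VectorCalculus.

Section Systems.
Context (R : realType) (C : calculus R) (k : constants R).
Variable w : component -> C.
Local Open Scope calculus_scope.

Let phi := w Phi.
Let mu := w Mu.
Let u i := w (Vel i).
Let p := w Prs.
Let B i := w (Mag i).
Let E i := w (Ele i).
Let J i := w (Cur i).
Let zero := cst C 0%R.
Let m_eps := cst C (mob k) * (eps C * eps C).
Let rho_d : R := ((rho_ k true - rho_ k false) / 2)%R.
Let hlam := cst C (hat_lambda k).

Definition diffuse_system : Prop :=
  [/\ dt phi + div (fun i => phi * u i) =~ div (fun i => m_eps * dx i mu),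
      mu =~ - (hlam * eps C * lap phi)
            + hlam * epsV C * (phi * phi * phi - phi),
      forall i,
        mix (rho_ k) phi * dt (u i)
        + advect (fun j => mix (rho_ k) phi * u j
                           - cst C rho_d * (m_eps * dx j mu)) u i
        =~ divT (stress (mix (eta_ k) phi) u p) i + mu * dx i phi
           + cross J B i + mix (rho_ k) phi * gravity C (grav k) i,
      div u =~ zero &
      [/\ forall i, dt (B i) + curl E i =~ zero,
          forall i, curl B i =~ cst C (mu0 k) * J i,
          forall i, J i =~ mix (sigma_ k) phi * (E i + cross u B i),
          div B =~ zero &
          div J =~ zero]].

Definition sharp_bulk_system (s : bool) : Prop :=
  [/\ forall i,
        cst C (rho_ k s) * (dt (u i) + advect u u i)
        =~ divT (stress (cst C (eta_ k s)) u p) i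
           + cross J B i + cst C (rho_ k s) * gravity C (grav k) i,
      div u =~ zero &
      [/\ forall i, dt (B i) + curl E i =~ zero,
          forall i, curl B i =~ cst C (mu0 k) * J i,
          forall i, J i =~ cst C (sigma_ k s) * (E i + cross u B i),
          div B =~ zero &
          div J =~ zero]].

End Systems.

Definition vec (R : realType) := 'rV[R]_3.
Definition stime (R : realType) : normedModType R := (R * 'rV[R]_3)%type.
(* (t, x, z), where z is the stretched variable *)
Definition istime (R : realType) : normedModType R :=
  (R * 'rV[R]_3 * R)%type.

Section Smoothness.
Context (R : realType) (V : normedModType R).
Implicit Types (A : set V) (f : V -> R).

Definition deriv (v : V) f : V -> R := fun q => 'D_v f q.

(* C^infty on A, for an open A and a finite-dimensional V *)
Definition smooth_on A f : Prop :=
  forall (vs : seq V) q, A q -> differentiable (foldr deriv f vs) q.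

Definition smooth_near A f : Prop :=
  exists N : set V, [/\ open N, A `<=` N & smooth_on N f].

(* f on A is the restriction of a function smooth on a neighbourhood of A' *)
Definition smooth_upto A A' f : Prop :=
  exists2 h : V -> R, smooth_near A' h & forall q, A q -> f q = h q.

End Smoothness.

Section ClassicalCalculus.
Context (R : realType).

Definition ev (i : 'I_3) : 'rV[R]_3 := delta_mx 0 i.

Definition d_t : (stime R -> R) -> stime R -> R := deriv (1 : R, 0 : 'rV[R]_3).
Definition d_x (i : 'I_3) : (stime R -> R) -> stime R -> R :=
  deriv (0 : R, ev i).
Definition laplacian (f : stime R -> R) : stime R -> R :=
  fun q => \sum_(i < 3) d_x i (d_x i f) q.

(* equations hold pointwise on A; e is the value of eps *)
Definition classical (A : set (stime R)) (e : R) : calculus R := {|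
  elt := stime R -> R;
  add := fun f g q => f q + g q;
  opp := fun f q => - f q;
  mul := fun f g q => f q * g q;
  cst := fun c _ => c;
  eps := fun _ => e;
  epsV := fun _ => e^-1;
  dt := d_t;
  dx := d_x;
  lap := laplacian;
  eqv := fun f g => forall q, A q -> f q = g q
|}.

End ClassicalCalculus.

Section Laurent.
Context (R : realType) (P : Type).

(* eps ^ (- pole) * \sum_k (lc k) eps ^ k; [lc 0] may vanish *)
Record laurent := Laurent { pole : nat; lc : nat -> P -> R }.

(* the coefficient of eps ^ n *)
Definition coef (a : laurent) (n : int) : P -> R :=
  if (n + (pole a)%:Z)%R is Posz j then lc a j else fun _ => 0.

Definition ladd (a b : laurent) : laurent :=
  let N := maxn (pole a) (pole b) in
  Laurent N (fun j q => coef a (j%:Z - N%:Z) q + coef b (j%:Z - N%:Z) q).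

Definition lmap (D : (P -> R) -> P -> R) (a : laurent) : laurent :=
  Laurent (pole a) (fun j => D (lc a j)).

Definition lmul (a b : laurent) : laurent :=
  Laurent (pole a + pole b)
    (fun j q => \sum_(i < j.+1) lc a i q * lc b (j - i)%N q).

Definition lfun (f : P -> R) : laurent :=
  Laurent 0 (fun j q => if j == 0%N then f q else 0).

Definition leps : laurent := Laurent 0 (fun j _ => (j == 1%N)%:R).
Definition lepsV : laurent := Laurent 1 (fun j _ => (j == 0%N)%:R).

Definition leqv (A : set P) (a b : laurent) : Prop :=
  forall n q, A q -> coef a n q = coef b n q.

Definition order_ge (a : laurent) (n : int) : Prop :=
  forall l, l < n -> forall q, coef a l q = 0.

(* r is an operator whose value at a series a is "O(eps ^ j)" relatively to a *)
Definition O_eps (j : nat) (r : laurent -> laurent) : Prop :=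
  forall a n, order_ge a n -> order_ge (r a) (n + j%:Z).

End Laurent.

Section SeriesCalculi.
Context (R : realType).

Definition outer (A : set (stime R)) : calculus R := {|
  elt := laurent R (stime R);
  add := @ladd _ _;
  opp := lmap (fun f q => - f q);
  mul := @lmul _ _;
  cst := fun c => lfun (fun _ => c);
  eps := leps R (stime R);
  epsV := lepsV R (stime R);
  dt := lmap (@d_t R);
  dx := fun i => lmap (@d_x R i);
  lap := lmap (@laplacian R);
  eqv := leqv A
|}.

Definition d_z : (istime R -> R) -> istime R -> R := 
  deriv (0 : R, 0 : 'rV[R]_3, 1 : R).
Definition di_x (i : 'I_3) : (istime R -> R) -> istime R -> R :=
  deriv (0 : R, ev R i, 0 : R).

(* in the sequel, the signed distance to the interface *)
Variable d : stime R -> R.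

Definition normal (i : 'I_3) : stime R -> R := d_x i d.
Definition normal_vec (q : stime R) : 'rV[R]_3 := \row_i normal i q.
Definition normal_velocity (q : stime R) : R := - d_t d q.
Definition curvature (q : stime R) : R := - laplacian d q.

(* The tangential part of the gradient; on the interface it depends only on the
   values of f there. *)
Definition surf_grad (i : 'I_3) (f : istime R -> R) : istime R -> R :=
  fun q => di_x i f q
           - normal i q.1 * \sum_(j < 3) normal j q.1 * di_x j f q.

(* The unspecified higher order terms of the rules for the derivatives
     d/dt  = - eps^-1 V d/dz + O(1),
     grad  = eps^-1 n d/dz + grad_Gamma + O(eps),
     Delta = eps^-2 d^2/dz^2 - eps^-1 kappa d/dz + O(1);
   the divergence and the curl are built from the components of grad. *)
Record remainders := Remainders {
  rem_t : laurent R (istime R) -> laurent R (istime R);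
  rem_x : 'I_3 -> laurent R (istime R) -> laurent R (istime R);
  rem_lap : laurent R (istime R) -> laurent R (istime R);
  rem_tO : O_eps 0 rem_t;
  rem_xO : forall i, O_eps 1 (rem_x i);
  rem_lapO : O_eps 0 rem_lap
}.

Definition inner (A : set (istime R)) (r : remainders) : calculus R := {|
  elt := laurent R (istime R);
  add := @ladd _ _;
  opp := lmap (fun f q => - f q);
  mul := @lmul _ _;
  cst := fun c => lfun (fun _ => c);
  eps := leps R (istime R);
  epsV := lepsV R (istime R);
  dt := fun a =>
    ladd (lmul (lepsV R (istime R))
            (lmap (fun f q => - normal_velocity q.1 * d_z f q) a))
         (rem_t r a);
  dx := fun i a =>
    ladd (ladd (lmul (lepsV R (istime R))
                  (lmap (fun f q => normal i q.1 * d_z f q) a))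
               (lmap (surf_grad i) a))
         (rem_x r i a);
  lap := fun a =>
    ladd (ladd (lmul (lmul (lepsV R (istime R)) (lepsV R (istime R)))
                  (lmap (fun f => d_z (d_z f)) a))
               (lmul (lepsV R (istime R))
                  (lmap (fun f q => - curvature q.1 * d_z f q) a)))
         (rem_lap r a);
  eqv := leqv A
|}.

End SeriesCalculi.

Section Geometry.
Context (R : realType).
Variables (T : R) (Omega : set (vec R)).
Variables (Om : bool -> R -> set (vec R)) (Gam : R -> set (vec R)).

Definition enorm (x : vec R) : R := Num.sqrt (\sum_(i < 3) x 0 i ^+ 2).

Definition edist (x : vec R) (A : set (vec R)) : R :=
  inf [set enorm (x - y) | y in A].

Definition sdist (q : stime R) : R :=
  if q.2 \in Om true q.1 then edist q.2 (Gam q.1) else - edist q.2 (Gam q.1).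

(* the space-time set swept by a moving set during the time interval ]0, T[ *)
Definition sweep (A : R -> set (vec R)) : set (stime R) :=
  [set q : stime R | (0 < q.1 < T) /\ A q.1 q.2].

Definition sweep_inner : set (istime R) := [set q | sweep Gam q.1].

Definition bounded_domain : Prop :=
  [/\ open Omega, connected Omega, bounded_set Omega & Omega !=set0].

(* The interface is a nonempty compact subset of Omega, hence away from the
   boundary of Omega, with both phases on either side of each of its points. It
   is smooth in the sense that the signed distance is smooth near it. *)
Definition evolving_interface : Prop :=
  [/\ forall t : R, 0 < t < T ->
        [/\ Omega = Om true t `|` Gam t `|` Om false t,
            [/\ Om true t `&` Om false t = set0,
                Om true t `&` Gam t = set0 & Om false t `&` Gam t = set0],
            Gam t !=set0, compact (Gam t) &
            forall s, Gam t `<=` closure (Om s t)],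
      forall s, open (sweep (Om s)),
      smooth_near (sweep Gam) sdist &
      forall q, sweep Gam q -> enorm (normal_vec sdist q) = 1].

(* the trace on the interface, from the side of the phase s *)
Definition trace (s : bool) (f : stime R -> R) (q : stime R) : R :=
  lim ((fun x : vec R => f (q.1, x)) @ within (Om s q.1) (nbhs q.2)).

Definition jump (f : bool -> stime R -> R) (q : stime R) : R :=
  trace true (f true) q - trace false (f false) q.

End Geometry.

Section Expansions.
Context (R : realType) (k : constants R).
Variables (T e0 : R) (Omega : set (vec R)).
Variables (Om : bool -> R -> set (vec R)) (Gam : R -> set (vec R)).

(* coefficients; those of mu start at the power eps ^ (-1) *)
Definition outer_coefs := bool -> component -> nat -> stime R -> R.
Definition inner_coefs := component -> nat -> istime R -> R.

Definition pole_of (c : component) : nat := if c is Mu then 1%N else 0%N.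

Definition series_of (P : Type) (X : component -> nat -> P -> R)
  (c : component) : laurent R P := Laurent (pole_of c) (X c).

Variable w : R -> component -> stime R -> R.

Definition solution_family : Prop :=
  forall e : R, 0 < e < e0 ->
    [/\ forall c, smooth_on (sweep T (fun=> Omega)) (w e c),
        @diffuse_system R (classical (sweep T (fun=> Omega)) e) k (w e) &
        forall t : R, 0 < t < T ->
          [/\ Om true t = [set x | Omega x /\ 0 < w e Phi (t, x)],
              Om false t = [set x | Omega x /\ w e Phi (t, x) < 0] &
              Gam t = [set x | Omega x /\ w e Phi (t, x) = 0]]].

(* f e ~ e ^ (- N) * \sum_j (a j) e ^ j  as e -> 0+, to all orders *)
Definition expands (f : R -> R) (N : nat) (a : nat -> R) : Prop :=
  forall n : nat,
    (fun e : R => (e ^+ N * f e - \sum_(j < n.+1) a j * e ^+ j) / e ^+ n)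
      @ 0^'+ --> (0 : R).

Let d := sdist Om Gam.

Definition outer_expansion (X : outer_coefs) : Prop :=
  [/\ forall s c j,
        smooth_upto (sweep T (Om s)) (sweep T (fun t => Om s t `|` Gam t))
          (X s c j),
      forall s c q, sweep T (Om s) q ->
        expands (fun e => w e c q) (pole_of c) (fun j => X s c j q),
      (forall q, sweep T (Om true) q -> 0 < X true Phi 0%N q) /\
      (forall q, sweep T (Om false) q -> X false Phi 0%N q < 0) &
      forall s, @diffuse_system R (outer (sweep T (Om s))) k
                  (series_of (X s))].

Definition inner_expansion (r : remainders R) (Y : inner_coefs) : Prop :=
  [/\ forall c j, smooth_near (sweep_inner T Gam) (Y c j),
      forall c q, sweep_inner T Gam q ->
        expands
          (fun e => w e c (q.1.1, q.1.2 + (e * q.2) *: normal_vec d q.1))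
          (pole_of c) (fun j => Y c j q) &
      @diffuse_system R (inner d (sweep_inner T Gam) r) k (series_of Y)].

Definition end_z (s : bool) : set_system R := if s then +oo else -oo.

Definition matching (X : outer_coefs) (Y : inner_coefs) : Prop :=
  forall s c q, sweep T Gam q ->
    [/\ (fun z => Y c 0%N (q, z)) @ end_z s --> trace Om s (X s c 0%N) q,
        (fun z => d_z (Y c 0%N) (q, z)) @ end_z s --> (0 : R) &
        (fun z => d_z (Y c 1%N) (q, z)) @ end_z s -->
          \sum_(i < 3) trace Om s (d_x i (X s c 0%N)) q * normal d i q].

End Expansions.

Section Sharp.
Context (R : realType) (k : constants R).
Variables (T : R).
Variables (Om : bool -> R -> set (vec R)) (Gam : R -> set (vec R)).
Variable v : bool -> component -> stime R -> R.

Let d := sdist Om Gam.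
Let n (q : stime R) (i : 'I_3) : R := normal d i q.
Let space : calculus R := classical setT 0.  (* only for its operations *)

Definition phase_stress (s : bool) : 'I_3 -> 'I_3 -> stime R -> R :=
  @stress R space (fun=> eta_ k s) (fun i => v s (Vel i)) (v s Prs).

Definition sharp_interface_conditions (q : stime R) : Prop :=
  [/\ forall i,
        \sum_(j < 3) jump Om (fun s => phase_stress s i j) q * n q j
        = - lambda k * curvature d q * n q i,
      forall i, jump Om (fun s => v s (Vel i)) q = 0,
      forall i, jump Om (fun s => v s (Mag i)) q = 0,
      forall i : 'I_3,  (* n x [E] = 0 *)
        n q (ordS i) * jump Om (fun s => v s (Ele (ordS (ordS i)))) q
        - n q (ordS (ordS i)) * jump Om (fun s => v s (Ele (ordS i))) q = 0 &
      \sum_(i < 3) jump Om (fun s => v s (Cur i)) q * n q i = 0 /\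
      forall s, normal_velocity d q
                = \sum_(i < 3) trace Om s (v s (Vel i)) q * n q i].

(* The bulk equations do not involve eps, here set to 0. *)
Definition sharp_model : Prop :=
  (forall s, @sharp_bulk_system R (classical (sweep T (Om s)) 0) k (v s) s)
  /\ (forall q, sweep T Gam q -> sharp_interface_conditions q).

End Sharp.

(* Main.v *)
(* Outer expansion: the order eps^-1 of the momentum equation reads
   (phi0^3 - phi0) grad phi0 = 0, so (phi0^2 - 1)^2 is constant along segments
   contained in one phase.

   Inner expansion, at a point of the interface with normal n and with ' = d/dz.
   The order eps^-1 of div u = 0 is n.u0' = 0; hence the normal component of the
   order eps^-2 of the momentum equation gives mu0 phi0' = 0, the remaining part
   gives (eta(phi0) u0')' = 0, and so eta(phi0) u0' = 0 by matching.  The order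
   eps^-1 of the phase equation is (u0.n - V) phi0' = m mu0''; integrating it
   over the line gives V = u0.n, after which mu0' = 0 and then mu0 = 0.  Thus
   phi0'' = phi0^3 - phi0 and the traces of phi0 are +1 and -1, first on the
   interface and then, Omega being connected, in the whole bulk.  The profile
   satisfies phi0' = (1 - phi0^2) / sqrt 2, so eta(phi0) > 0 and u0' = 0.

   The order eps^-1 of the momentum equation is then (T0 n)' + mu1 phi0' n = 0,
   with T0 the order 0 stress, and mu1 phi0' is an exact derivative up to
   hat_lambda kappa phi0'^2, whose integral is lambda kappa. *)

Require Import Defs.
From mathcomp Require Import all_boot all_order all_algebra.
From mathcomp Require Import all_classical all_reals all_analysis.
From mathcomp Require Import ring lra zify.

Set Implicit Arguments.
Unset Strict Implicit.
Unset Printing Implicit Defensive.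

Import Order.TTheory GRing.Theory Num.Theory.
Import numFieldNormedType.Exports.

Local Open Scope classical_set_scope.
Local Open Scope ring_scope.

(** * Leading coefficients of formal series *)

(** The viscosity [mix (eta_ k) phi] is affine in the phase, so it may vanish or turn negative where
    the phase leaves the interval from -1 to 1. Continuity of the velocity therefore cannot come
    first: until the profile is known, only n.u0' = 0 is available, and this is just enough for the
    phase equation. The strict sign of phi0 in the bulk does not pass to the interface by itself,
    yet distinct traces are needed to obtain V = u0.n. The well (phi0^2 - 1)^2 excludes a zero trace
    before mu0 is known to vanish. Matching controls the derivative of phi1 and not phi1 itself. The
    boundary terms containing phi1 in the exact derivative are disposed of by the exponential decay
    of 1 - phi0^2. The inner equations hold on the interface only, whereas [surf_grad] is written
    with derivatives in all of space. Tangential derivatives are handled by applying it to functions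
    that vanish on the interface. *)

Section LeadingCoefficients.
Context (R : realType) (P : Type).
Implicit Types (a b : laurent R P) (f g : P -> R) (n m : int).

(* a = eps^n (f + eps g + O(eps^2)), everywhere and not only on the set where the
   equations hold, so that the coefficients can be differentiated. *)
Definition lead a n f g : Prop :=
  [/\ order_ge a n, forall q, coef a n q = f q & forall q, coef a (n + 1) q = g q].

Lemma coef_lc a j : coef a (j%:Z - (pole a)%:Z) = lc a j.
Proof. by rewrite /coef subrK. Qed.

Lemma coef_below a n q : n + (pole a)%:Z < 0 -> coef a n q = 0.
Proof. by rewrite /coef; case: (n + _). Qed.

Lemma lc_coef a n q : 0 <= n + (pole a)%:Z ->
  coef a n q = lc a (absz (n + (pole a)%:Z)) q.
Proof. by rewrite /coef; case: (n + _). Qed.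

Lemma coef_ladd a b n q : coef (ladd a b) n q = coef a n q + coef b n q.
Proof.
have [h|h] := ltP (n + (maxn (pole a) (pole b))%:Z) 0.
  by rewrite !coef_below ?addr0 //=; lia.
rewrite (@lc_coef (ladd a b)) //=. congr (_ + _); congr coef; lia.
Qed.

Lemma coef_lmap (D : (P -> R) -> P -> R) a n : D (fun=> 0) = (fun=> 0) ->
  coef (lmap D a) n = D (coef a n).
Proof. by move=> D0; rewrite /coef /=; case: (n + _). Qed.

(** Both windows contain the support of [F], so both sums equal the sum over the smallest interval
    containing the two. This reindexes a Cauchy product from the poles to the actual orders. *)
Lemma sum_int_widen (F : int -> R) (x y : int) (L M : nat) :
  (forall i, i < x \/ x + L%:Z <= i -> F i = 0) ->
  (forall i, i < y \/ y + M%:Z <= i -> F i = 0) ->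
  \sum_(i < L) F (x + i%:Z) = \sum_(i < M) F (y + i%:Z).
Proof.
have widen (u : int) (K K' K'' : nat) :
    (forall i, i < u + K%:Z \/ u + K%:Z + K'%:Z <= i -> F i = 0) ->
    \sum_(i < K + K' + K'') F (u + i%:Z) = \sum_(i < K') F (u + K%:Z + i%:Z).
  move=> F0; rewrite big_split_ord big_split_ord /=.
  rewrite big1 ?add0r => [|i _]; last by apply: F0; left; have := ltn_ord i; lia.
  rewrite [X in _ + X]big1 ?addr0 => [|i _]; last by apply: F0; right; lia.
  by apply: eq_bigr => i _; rewrite PoszD addrA.
move=> Fx Fy.
pose u := Order.min x y.
pose e := Order.max (x + L%:Z) (y + M%:Z).
have h (z : int) (K : nat) : u <= z -> z + K%:Z <= e ->
    (forall i, i < z \/ z + K%:Z <= i -> F i = 0) ->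
    \sum_(i < K) F (z + i%:Z) = \sum_(i < absz (e - u)) F (u + i%:Z).
  move=> uz ze Fz.
  have -> : absz (e - u) = (absz (z - u)%R + K + absz (e - (z + K%:Z))%R)%N by lia.
  have zE : u + (absz (z - u))%:Z = z by lia.
  by rewrite widen zE.
by rewrite !h // /u /e ?ge_min ?le_max lexx ?orbT.
Qed.

(* na and nb may differ from the poles of a and b: this is a Cauchy product
   starting at arbitrary lower bounds of the orders. *)
Lemma coef_lmul a b n q na nb (M : nat) :
  order_ge a na -> order_ge b nb -> n - na - nb < M%:Z ->
  coef (lmul a b) n q =
  \sum_(i < M) coef a (na + i%:Z) q * coef b (n - (na + i%:Z)) q.
Proof.
move=> ha hb hM; pose F i := coef a i q * coef b (n - i) q.
have Fna i : i < na -> F i = 0 by move=> ?; rewrite /F ha ?mul0r.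
have Fnb i : n - nb < i -> F i = 0 by move=> ?; rewrite /F hb ?mulr0 //; lia.
have Fpa i : i < - (pole a)%:Z -> F i = 0.
  by move=> ?; rewrite /F coef_below ?mul0r //; lia.
have Fpb i : n + (pole b)%:Z < i -> F i = 0.
  by move=> ?; rewrite /F (@coef_below b) ?mulr0 //; lia.
have out i : i < na \/ na + M%:Z <= i -> F i = 0.
  by case=> ?; [exact: Fna | apply: Fnb; lia].
have [h|h] := ltP (n + (pole a + pole b)%N%:Z) 0.
  rewrite coef_below // big1 // => i _; rewrite -/(F _).
  by have [?|?] := ltP (na + i%:Z) (- (pole a)%:Z); [exact: Fpa|apply: Fpb; lia].
rewrite (@lc_coef (lmul a b)) //=; set J := absz _.
rewrite -(@sum_int_widen F (- (pole a)%:Z) na J.+1 M) //.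
  apply: eq_bigr => i _; rewrite /F -!coef_lc addrC; congr (coef _ _ _ * coef _ _ _).
  by have := ltn_ord i; rewrite /J; lia.
by move=> i [?|?]; [exact: Fpa | apply: Fpb; rewrite /J in h *; lia].
Qed.

Lemma lead_eqf a n f g f' g' : lead a n f g -> f =1 f' -> g =1 g' ->
  lead a n f' g'.
Proof. by move=> [? h1 h2] e1 e2; split=> // q; rewrite -?e1 -?e2. Qed.

(** Aligns terms of unequal orders before they are added. *)
Lemma lead_lower a n f g : lead a (n + 1) f g -> lead a n (fun=> 0) f.
Proof.
by move=> [h h1 h2]; split=> // [l ln|q]; apply: h; [apply: lt_trans ln _|]; rewrite ltrDl.
Qed.

Lemma lead_add a b n f g f' g' : lead a n f g -> lead b n f' g' ->
  lead (ladd a b) n (fun q => f q + f' q) (fun q => g q + g' q).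
Proof.
move=> [a0 a1 a2] [b0 b1 b2]; split=> [l ln|q|q]; last 2 first.
- by rewrite coef_ladd a1 b1.
- by rewrite coef_ladd a2 b2.
by move=> q; rewrite coef_ladd a0 ?b0 ?addr0.
Qed.

Lemma lead_lmap (D : (P -> R) -> P -> R) a n f g : D (fun=> 0) = (fun=> 0) ->
  lead a n f g -> lead (lmap D a) n (D f) (D g).
Proof.
move=> D0 [a0 /funext a1 /funext a2]; split=> [l ln|q|q]; rewrite coef_lmap ?a1 ?a2 //.
have -> : coef a l = fun=> 0 by apply/funext => q; exact: a0.
by rewrite D0.
Qed.

Lemma lead_opp a n f g : lead a n f g ->
  lead (lmap (fun f q => - f q) a) n (fun q => - f q) (fun q => - g q).
Proof.
by apply: (@lead_lmap (fun f q => - f q)); apply/funext => q; rewrite oppr0.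
Qed.

Lemma lead_mul a b n m f g f' g' : lead a n f g -> lead b m f' g' ->
  lead (lmul a b) (n + m) (fun q => f q * f' q) (fun q => f q * g' q + g q * f' q).
Proof.
move=> [a0 a1 a2] [b0 b1 b2]; split=> [l ln q|q|q].
- by rewrite (@coef_lmul _ _ _ _ n m 0) ?big_ord0 //; lia.
- rewrite (@coef_lmul _ _ _ _ n m 1) ?big_ord1 ?addr0 //; last lia.
  by rewrite [n + m]addrC addrK a1 b1.
- rewrite (@coef_lmul _ _ _ _ n m 2) ?big_ord_recl ?big_ord0 ?addr0 //; last lia.
  rewrite /= a1 a2; congr (_ * _ + _ * _).
    by rewrite -b2; congr coef; lia.
  by rewrite -b1; congr coef; rewrite /bump /=; lia.
Qed.

Lemma lead_fun f : lead (lfun f) 0 f (fun=> 0).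
Proof. by split=> // [[l|l]] //=. Qed.

Lemma lead_zero n : lead (lfun (fun _ : P => 0)) n (fun=> 0) (fun=> 0).
Proof.
have h l q : coef (lfun (fun _ : P => 0 : R)) l q = 0.
  by rewrite /coef; case: (l + _) => //= j; rewrite if_same.
by split=> // l _ q; exact: h.
Qed.

Lemma lead_eps : lead (leps R P) 1 (fun=> 1) (fun=> 0).
Proof. by split=> // [[[|l]|l]]. Qed.

Lemma lead_epsV : lead (lepsV R P) (-1) (fun=> 1) (fun=> 0).
Proof. by split=> // [[l|l]] //; rewrite /coef /=; case: l. Qed.

Lemma lead_series (X : component -> nat -> P -> R) c :
  lead (series_of X c) (- (pole_of c)%:Z) (X c 0%N) (X c 1%N).
Proof.
split=> [l ln q|q|q]; first by rewrite coef_below //=; lia.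
  by rewrite /coef /= addNr.
by rewrite /coef /= addrAC addNr.
Qed.

Lemma leqv_lead A a b n f g f' g' : leqv A a b -> lead a n f g ->
  lead b n f' g' -> (forall q, A q -> f q = f' q) /\ (forall q, A q -> g q = g' q).
Proof.
move=> ab [_ a1 a2] [_ b1 b2]; split=> q Aq.
  by rewrite -a1 -b1 ab.
by rewrite -a2 -b2 ab.
Qed.

Lemma lead_O_eps (j : nat) (rem : laurent R P -> laurent R P) a n f g :
  O_eps j rem -> lead a n f g -> order_ge (rem a) (n + j%:Z).
Proof. by move=> h [a0 _ _]; exact: h. Qed.

End LeadingCoefficients.
Arguments lead_lower {R P} [a] n [f g].

Section LeadingCoefficientRules.
Context (R : realType).

Lemma lead_sum3 (P : Type) (v : 'I_3 -> laurent R P) n (f g : 'I_3 -> P -> R) :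
  (forall i, lead (v i) n (f i) (g i)) ->
  lead (\big[@ladd R P/lfun (fun=> 0)]_(i < 3) v i) n
    (fun q => \sum_(i < 3) f i q) (fun q => \sum_(i < 3) g i q).
Proof.
move=> h; have h0 : lead (lfun (fun _ : P => 0 : R)) n (fun=> 0) (fun=> 0).
  exact: lead_zero.
rewrite !big_ord_recl big_ord0.
have := lead_add (h ord0) (lead_add (h (lift ord0 ord0))
  (lead_add (h (lift ord0 (lift ord0 ord0))) h0)).
by move/lead_eqf; apply=> q; rewrite /= !big_ord_recl big_ord0.
Qed.

Lemma lead_vanish (P : Type) (a : laurent R P) n :
  order_ge a (n + 2) -> lead a n (fun=> 0) (fun=> 0).
Proof. by move=> a0; split=> [l ln q|q|q]; apply: a0; lia. Qed.

(** Keeps the second coefficient symbolic, for series that are known at the leading order only. *)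
Lemma lead_head (P : Type) (a : laurent R P) n f g :
  lead a n f g -> lead a n f (coef a (n + 1)).
Proof. by case. Qed.

Lemma deriv_cst0 (V : normedModType R) (v : V) : Defs.deriv v (fun=> 0) = (fun=> 0 : R).
Proof. by apply/funext => q; exact: derive_cst. Qed.

Lemma laplacian_cst0 : laplacian (fun=> 0) = (fun=> 0 : R).
Proof.
by apply/funext => q; rewrite /laplacian big1 // => i _; rewrite /d_x !deriv_cst0.
Qed.

Lemma lead_mix (P : Type) (c : bool -> R) (a : laurent R P) f g :
  lead a 0 f g ->
  lead (ladd (lmul (lfun (fun=> (c true - c false) / 2)) a)
             (lfun (fun=> (c true + c false) / 2))) 0
    (fun q => (c true - c false) / 2 * f q + (c true + c false) / 2)
    (fun q => (c true - c false) / 2 * g q).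
Proof.
move=> h.
have := lead_add
  (lead_mul (lead_fun (fun _ : P => (c true - c false) / 2)) h)
  (lead_fun (fun _ : P => (c true + c false) / 2)).
by move/lead_eqf; apply=> q /=; rewrite ?mul0r ?addr0.
Qed.

Section Inner.
Variables (d : stime R -> R) (A : set (istime R)) (r : remainders R).
Let C := inner d A r.

Lemma surf_grad_cst0 i : surf_grad d i (fun=> 0) = (fun=> 0).
Proof.
apply/funext => q; rewrite /surf_grad big1 => [|j _];
  by rewrite /di_x deriv_cst0 ?mulr0 ?subr0.
Qed.

Lemma lead_inner_dx (a : laurent R (istime R)) n f g i : lead a n f g ->
  lead (@dx R C i a) (n - 1) (fun q => normal d i q.1 * d_z f q)
    (fun q => normal d i q.1 * d_z g q + surf_grad d i f q).
Proof.
move=> h.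
pose Dz := fun (f : istime R -> R) q => normal d i q.1 * d_z f q.
have dz0 : Dz (fun=> 0) = fun=> 0.
  by apply/funext => q; rewrite /Dz /d_z deriv_cst0 mulr0.
have h1 := lead_mul (lead_epsV R (istime R)) (@lead_lmap _ _ Dz _ _ _ _ dz0 h).
have h2 := lead_lmap (surf_grad_cst0 i) h.
have {}h2 : lead (lmap (surf_grad d i) a) (-1 + n) (fun=> 0) (surf_grad d i f).
  by apply: lead_lower; move: h2; congr lead; lia.
have h3 : lead (rem_x r i a) (-1 + n) (fun=> 0) (fun=> 0).
  apply: lead_vanish; have := lead_O_eps (rem_xO r i) h.
  by congr order_ge; lia.
have := lead_add (lead_add h1 h2) h3; rewrite [-1 + n]addrC.
by move/lead_eqf; apply=> q /=; rewrite ?mul1r ?mul0r ?addr0.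
Qed.

(** The remainder is [O(1)] and enters one order after the leading term, so the second coefficient
    stays opaque. For [lead_inner_dx] and [lead_inner_lap] the remainder enters two orders after it,
    and two coefficients are explicit. *)
Lemma lead_inner_dt (a : laurent R (istime R)) n f g : lead a n f g ->
  lead (@dt R C a) (n - 1) (fun q => - normal_velocity d q.1 * d_z f q)
    (coef (@dt R C a) n).
Proof.
move=> h.
pose Dz := fun (f : istime R -> R) q => - normal_velocity d q.1 * d_z f q.
have dz0 : Dz (fun=> 0) = fun=> 0.
  by apply/funext => q; rewrite /Dz /d_z deriv_cst0 mulr0.
have h1 := lead_mul (lead_epsV R (istime R)) (@lead_lmap _ _ Dz _ _ _ _ dz0 h).
have h2 : lead (rem_t r a) (-1 + n) (fun=> 0) (coef (rem_t r a) n).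
  have := lead_O_eps (rem_tO r) h; rewrite addr0 => h0.
  split=> [l ln q|q|q]; [by apply: h0; lia|by apply: h0; lia|].
  by congr coef; lia.
have := lead_head (lead_add h1 h2); rewrite [-1 + n]addrC subrK.
by move/lead_eqf; apply=> q //=; rewrite ?mul1r ?addr0.
Qed.

Lemma lead_inner_lap (a : laurent R (istime R)) n f g : lead a n f g ->
  lead (@lap R C a) (n - 2) (d_z (d_z f))
    (fun q => d_z (d_z g) q - curvature d q.1 * d_z f q).
Proof.
move=> h.
have dzz0 : (fun f => d_z (d_z f)) (fun=> 0) = (fun=> 0 : R) by rewrite /d_z !deriv_cst0.
pose Dz := fun (f : istime R -> R) q => - curvature d q.1 * d_z f q.
have k0 : Dz (fun=> 0) = fun=> 0.
  by apply/funext => q; rewrite /Dz /d_z deriv_cst0 mulr0.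
have hV := lead_epsV R (istime R).
have h1 := lead_mul (lead_mul hV hV) (@lead_lmap _ _ (fun f => d_z (d_z f)) _ _ _ _ dzz0 h).
have h2 := lead_mul hV (@lead_lmap _ _ Dz _ _ _ _ k0 h).
(* The order of [h2] is cast to one more than the order of [h1]; the equality of integers is
   discharged on the next line. *)
have {}h2 := lead_lower _ (eq_rect _ (fun m => lead _ m _ _) h2 (-1 - 1 + n + 1) _).
have {}h2 := h2 ltac:(lia).
have h3 : lead (rem_lap r a) (-1 - 1 + n) (fun=> 0) (fun=> 0).
  apply: lead_vanish; have := lead_O_eps (rem_lapO r) h.
  by congr order_ge; lia.
have := lead_add (lead_add h1 h2) h3; rewrite (_ : -1 - 1 + n = n - 2); last lia.
move/lead_eqf; apply=> q /=; rewrite ?mul1r ?mul0r ?mulr0 ?addr0 //.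
by rewrite mul0r addr0 /Dz mulNr.
Qed.

End Inner.
End LeadingCoefficientRules.

(** * Equations of the inner expansion, order by order *)

Section InnerEquations.
Context (R : realType) (k : constants R) (d : stime R -> R).
Variables (A : set (istime R)) (r : remainders R) (Y : inner_coefs R).
Hypothesis sysY : @diffuse_system R (inner d A r) k (series_of Y).

Let C := inner d A r.
Local Notation n i q := (normal d i q.1).
Local Notation V q := (normal_velocity d q.1).
Local Notation phi j := (Y Phi j).
Local Notation mu j := (Y Mu j).
Local Notation u i j := (Y (Vel i) j).
Local Notation p j := (Y Prs j).
Local Notation B i j := (Y (Mag i) j).
Local Notation E i j := (Y (Ele i) j).
Local Notation J i j := (Y (Cur i) j).
Local Notation eta0 q := ((eta_ k true - eta_ k false) / 2 * phi 0%N q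
  + (eta_ k true + eta_ k false) / 2).
Local Notation eta1 q := ((eta_ k true - eta_ k false) / 2 * phi 1%N q).

Let Lphi : lead (series_of Y Phi) 0 (phi 0%N) (phi 1%N) := lead_series Y Phi.
Let Lmu : lead (series_of Y Mu) (-1) (mu 0%N) (mu 1%N) := lead_series Y Mu.
Let Lu i : lead (series_of Y (Vel i)) 0 (u i 0%N) (u i 1%N) := lead_series Y (Vel i).
Let Lp : lead (series_of Y Prs) 0 (p 0%N) (p 1%N) := lead_series Y Prs.
Let LB i : lead (series_of Y (Mag i)) 0 (B i 0%N) (B i 1%N) := lead_series Y (Mag i).
Let LE i : lead (series_of Y (Ele i)) 0 (E i 0%N) (E i 1%N) := lead_series Y (Ele i).
Let LJ i : lead (series_of Y (Cur i)) 0 (J i 0%N) (J i 1%N) := lead_series Y (Cur i).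

Let Ldx i := fun (a : laurent R (istime R)) m f g => @lead_inner_dx R d A r a m f g i.
Arguments Ldx i {a m f g}.

(** The inner gradient of mu has order -2. A mobility of order [eps^2] brings the flux to order 0,
    so that its divergence meets the transport terms at order -1. *)
Let Lmeps_dmu i : lead (@Defs.mul R C
    (@Defs.mul R C (Defs.cst C (mob k)) (@Defs.mul R C (eps C) (eps C)))
    (@dx R C i (series_of Y Mu))) 0
  (fun q => mob k * (n i q * d_z (mu 0%N) q))
  (fun q => mob k * (n i q * d_z (mu 1%N) q + surf_grad d i (mu 0%N) q)).
Proof.
have he := lead_eps R (istime R).
have := lead_mul (lead_mul (lead_fun (fun=> mob k)) (lead_mul he he)) (Ldx i Lmu).
by move/lead_eqf; apply=> q; rewrite /=; ring.
Qed.

Lemma inner_div_orderN1 (v : 'I_3 -> laurent R (istime R)) f g :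
  (forall i, lead (v i) 0 (f i) (g i)) -> eqv (@Defs.div R C v) (Defs.cst C 0) ->
  forall q, A q -> \sum_(i < 3) n i q * d_z (f i) q = 0.
Proof.
move=> hv /leqv_lead h.
by have [? _] := h _ _ _ _ _ (lead_sum3 (fun i => Ldx i (hv i))) (lead_zero _ _ _).
Qed.

Lemma inner_div_velocity q : A q -> \sum_(i < 3) n i q * d_z (u i 0%N) q = 0.
Proof. by case: sysY => _ _ _ h _; exact: (inner_div_orderN1 Lu h). Qed.

Lemma inner_div_magnetic q : A q -> \sum_(i < 3) n i q * d_z (B i 0%N) q = 0.
Proof. by case: sysY => _ _ _ _ [_ _ _ h _]; exact: (inner_div_orderN1 LB h). Qed.

Lemma inner_div_current q : A q -> \sum_(i < 3) n i q * d_z (J i 0%N) q = 0.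
Proof. by case: sysY => _ _ _ _ [_ _ _ _ h]; exact: (inner_div_orderN1 LJ h). Qed.

Lemma inner_curl_magnetic i q : A q ->
  n (ordS i) q * d_z (B (ordS (ordS i)) 0%N) q
  - n (ordS (ordS i)) q * d_z (B (ordS i) 0%N) q = 0.
Proof.
case: sysY => _ _ _ _ [_ + _ _ _] => /(_ i) /leqv_lead h.
have L1 := lead_add (Ldx (ordS i) (LB (ordS (ordS i))))
  (lead_opp (Ldx (ordS (ordS i)) (LB (ordS i)))).
(* The current has order 0, so the right-hand side contributes nothing at order -1. *)
have L2 := lead_lower (-1) (lead_mul (lead_fun (fun=> mu0 k)) (LJ i)).
by have [e _] := h _ _ _ _ _ L1 L2 => /e.
Qed.

Lemma inner_faraday i q : A q ->
  - V q * d_z (B i 0%N) q + (n (ordS i) q * d_z (E (ordS (ordS i)) 0%N) q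
  - n (ordS (ordS i)) q * d_z (E (ordS i) 0%N) q) = 0.
Proof.
case: sysY => _ _ _ _ [+ _ _ _ _] => /(_ i) /leqv_lead h.
have L1 := lead_add (lead_inner_dt d A r (LB i))
  (lead_add (Ldx (ordS i) (LE (ordS (ordS i))))
    (lead_opp (Ldx (ordS (ordS i)) (LE (ordS i))))).
by have [e _] := h _ _ _ _ _ L1 (lead_zero _ _ _) => /e.
Qed.

Lemma inner_phase q : A q ->
  - V q * d_z (phi 0%N) q
  + \sum_(i < 3) n i q * d_z (fun q => phi 0%N q * u i 0%N q) q
  = \sum_(i < 3) n i q * d_z (fun q => mob k * (n i q * d_z (mu 0%N) q)) q.
Proof.
case: sysY => + _ _ _ _ => /leqv_lead h.
have L1 := lead_add (lead_inner_dt d A r Lphi)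
  (lead_sum3 (fun i => Ldx i (lead_mul Lphi (Lu i)))).
have L2 := lead_sum3 (fun i => Ldx i (Lmeps_dmu i)).
by have [e _] := h _ _ _ _ _ L1 L2 => /e.
Qed.

Lemma inner_potential q : A q ->
  mu 0%N q = hat_lambda k * (- d_z (d_z (phi 0%N)) q + phi 0%N q ^+ 3 - phi 0%N q) /\
  mu 1%N q = hat_lambda k * (- d_z (d_z (phi 1%N)) q
    + curvature d q.1 * d_z (phi 0%N) q + (3 * phi 0%N q ^+ 2 - 1) * phi 1%N q).
Proof.
case: sysY => _ + _ _ _ => /leqv_lead h.
have Lh := lead_fun (fun _ : istime R => hat_lambda k).
have L2 := lead_add
  (lead_opp (lead_mul (lead_mul Lh (lead_eps R (istime R))) (lead_inner_lap d A r Lphi)))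
  (lead_mul (lead_mul Lh (lead_epsV R (istime R)))
    (lead_add (lead_mul (lead_mul Lphi Lphi) Lphi) (lead_opp Lphi))).
have [e1 e2] := h _ _ _ _ _ Lmu L2.
move=> Aq; rewrite (e1 _ Aq) (e2 _ Aq) /=.
move: (d_z (d_z (phi 0%N)) q) (d_z (d_z (phi 1%N)) q) (d_z (phi 0%N) q) (curvature d q.1).
move: (phi 0%N q) (phi 1%N q) (hat_lambda k) => a b l a'' b'' a' kap.
by split; ring.
Qed.

Definition inner_strainN1 i j q :=
  2^-1 * (n j q * d_z (u i 0%N) q + n i q * d_z (u j 0%N) q).
Definition inner_strain0 i j q :=
  2^-1 * (n j q * d_z (u i 1%N) q + surf_grad d j (u i 0%N) q
          + (n i q * d_z (u j 1%N) q + surf_grad d i (u j 0%N) q)).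
Definition inner_stressN1 i j q := 2 * eta0 q * inner_strainN1 i j q.
Definition inner_stress0 i j q :=
  2 * eta0 q * inner_strain0 i j q + 2 * eta1 q * inner_strainN1 i j q
  - (i == j)%:R * p 0%N q.

Let Lstress i j : lead (@stress R C (@mix R C (eta_ k) (series_of Y Phi))
  (fun i => series_of Y (Vel i)) (series_of Y Prs) i j) (-1)
  (inner_stressN1 i j) (inner_stress0 i j).
Proof.
have := lead_add (lead_mul (lead_mul (lead_fun (fun=> 2)) (lead_mix (eta_ k) Lphi))
    (lead_mul (lead_fun (fun=> 2^-1)) (lead_add (Ldx j (Lu i)) (Ldx i (Lu j)))))
  (lead_lower (-1) (lead_opp (lead_mul (lead_fun (fun=> (i == j)%:R)) Lp))).
move/lead_eqf; apply=> q /=.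
  by rewrite addr0.
have zero (c e e' h a v pr : R) : c * e * (h * a + 0 * v) + (c * e' + 0 * e) * (h * v) - pr
    = c * e * (h * a) + c * e' * (h * v) - pr by ring.
exact: zero.
Qed.

Lemma inner_momentum i q : A q ->
  \sum_(j < 3) n j q * d_z (inner_stressN1 i j) q + mu 0%N q * (n i q * d_z (phi 0%N) q) = 0
  /\
  ((rho_ k true - rho_ k false) / 2 * phi 0%N q + (rho_ k true + rho_ k false) / 2)
    * (- V q * d_z (u i 0%N) q)
  + \sum_(j < 3)
     (((rho_ k true - rho_ k false) / 2 * phi 0%N q + (rho_ k true + rho_ k false) / 2)
        * u j 0%N q
      - (rho_ k true - rho_ k false) / 2 * (mob k * (n j q * d_z (mu 0%N) q)))
     * (n j q * d_z (u i 0%N) q)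
  = \sum_(j < 3) (n j q * d_z (inner_stress0 i j) q + surf_grad d j (inner_stressN1 i j) q)
    + (mu 0%N q * (n i q * d_z (phi 1%N) q + surf_grad d i (phi 0%N) q)
       + mu 1%N q * (n i q * d_z (phi 0%N) q)).
Proof.
case: sysY => _ _ + _ _ => /(_ i) /leqv_lead h.
have Lrho := lead_mix (rho_ k) Lphi.
have L1 := lead_lower (-2) (lead_add (lead_mul Lrho (lead_inner_dt d A r (Lu i)))
  (lead_sum3 (fun j => lead_mul
    (lead_add (lead_mul Lrho (Lu j))
      (lead_opp (lead_mul (lead_fun (fun=> (rho_ k true - rho_ k false) / 2))
                  (Lmeps_dmu j)))) (Ldx j (Lu i))))).
have LJB := lead_add (lead_mul (LJ (ordS i)) (LB (ordS (ordS i))))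
  (lead_opp (lead_mul (LJ (ordS (ordS i))) (LB (ordS i)))).
have Lg := lead_mul Lrho
  (lead_fun (fun _ : istime R => if i == ord_max then - grav k else 0)).
(* The Lorentz force and gravity have order 0: lowered twice, they drop out of the orders -2 and
   -1. *)
have L2 := lead_add (lead_add (lead_add (lead_sum3 (fun j => Ldx j (Lstress i j)))
  (lead_mul Lmu (Ldx i Lphi))) (lead_lower (-2) (lead_lower (-1) LJB)))
  (lead_lower (-2) (lead_lower (-1) Lg)).
have [e1 e2] := h _ _ _ _ _ L1 L2.
move=> Aq; have := e1 _ Aq; have := e2 _ Aq; rewrite /= !addr0 => -> <-.
by split.
Qed.

End InnerEquations.

(** * Equations of the outer expansion *)

Section OuterEquations.
Context (R : realType) (k : constants R) (A : set (stime R)).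
Variable X : component -> nat -> stime R -> R.
Hypothesis sysX : @diffuse_system R (outer A) k (series_of X).

Let C := outer A.
Let K := classical A 0.
Local Notation phi j := (X Phi j).
Local Notation mu j := (X Mu j).
Local Notation u i j := (X (Vel i) j).
Local Notation p j := (X Prs j).
Local Notation B i j := (X (Mag i) j).
Local Notation E i j := (X (Ele i) j).
Local Notation J i j := (X (Cur i) j).

Let Lphi : lead (series_of X Phi) 0 (phi 0%N) (phi 1%N) := lead_series X Phi.
Let Lmu : lead (series_of X Mu) (-1) (mu 0%N) (mu 1%N) := lead_series X Mu.
Let Lu i : lead (series_of X (Vel i)) 0 (u i 0%N) (u i 1%N) := lead_series X (Vel i).
Let Lp : lead (series_of X Prs) 0 (p 0%N) (p 1%N) := lead_series X Prs.
Let LB i : lead (series_of X (Mag i)) 0 (B i 0%N) (B i 1%N) := lead_series X (Mag i).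
Let LE i : lead (series_of X (Ele i)) 0 (E i 0%N) (E i 1%N) := lead_series X (Ele i).
Let LJ i : lead (series_of X (Cur i)) 0 (J i 0%N) (J i 1%N) := lead_series X (Cur i).

Let Ldx i (a : laurent R (stime R)) m f g (h : lead a m f g) :
  lead (@dx R C i a) m (d_x i f) (d_x i g) :=
  @lead_lmap _ _ (@d_x R i) _ _ _ _ (deriv_cst0 _) h.
Let Ldt (a : laurent R (stime R)) m f g (h : lead a m f g) :
  lead (@dt R C a) m (@d_t R f) (@d_t R g) :=
  @lead_lmap _ _ (@d_t R) _ _ _ _ (deriv_cst0 _) h.

Lemma sum3_classical (v : 'I_3 -> K) q : @sum3 R K v q = \sum_(i < 3) v i q.
Proof. by rewrite /sum3 !big_ord_recl !big_ord0. Qed.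

Lemma outer_div (v : 'I_3 -> laurent R (stime R)) f g :
  (forall i, lead (v i) 0 (f i) (g i)) -> eqv (@Defs.div R C v) (Defs.cst C 0) ->
  @eqv R K (@Defs.div R K f) (Defs.cst K 0).
Proof.
move=> hv /leqv_lead h q Aq; rewrite /Defs.div sum3_classical.
by have [+ _] := h _ _ _ _ _ (lead_sum3 (fun i => Ldx i (hv i))) (lead_zero _ _ _); apply.
Qed.

Lemma outer_linear_equations :
  [/\ @eqv R K (@Defs.div R K (fun i => u i 0%N)) (Defs.cst K 0),
      forall i, @eqv R K (@Defs.add R K (@dt R K (B i 0%N)) (@curl R K (fun i => E i 0%N) i))
                  (Defs.cst K 0),
      forall i, @eqv R K (@curl R K (fun i => B i 0%N) i)
                  (@Defs.mul R K (Defs.cst K (mu0 k)) (J i 0%N)),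
      @eqv R K (@Defs.div R K (fun i => B i 0%N)) (Defs.cst K 0) &
      @eqv R K (@Defs.div R K (fun i => J i 0%N)) (Defs.cst K 0)].
Proof.
case: sysX => _ _ _ hu [hE hB _ hdB hdJ].
split; first exact: outer_div Lu hu; last 2 first.
- exact: outer_div LB hdB.
- exact: outer_div LJ hdJ.
- move=> i q Aq; have /leqv_lead h := hE i.
  have L1 := lead_add (Ldt (LB i)) (lead_add (Ldx (ordS i) (LE (ordS (ordS i))))
    (lead_opp (Ldx (ordS (ordS i)) (LE (ordS i))))).
  by have [+ _] := h _ _ _ _ _ L1 (lead_zero _ _ _); apply.
- move=> i q Aq; have /leqv_lead h := hB i.
  have L1 := lead_add (Ldx (ordS i) (LB (ordS (ordS i))))
    (lead_opp (Ldx (ordS (ordS i)) (LB (ordS i)))).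
  have L2 := lead_mul (lead_fun (fun=> mu0 k)) (LJ i).
  by have [+ _] := h _ _ _ _ _ L1 L2; apply.
Qed.

Lemma outer_ohm i : @eqv R K (J i 0%N) (@Defs.mul R K (@mix R K (sigma_ k) (phi 0%N))
  (@Defs.add R K (E i 0%N) (@cross R K (fun i => u i 0%N) (fun i => B i 0%N) i))).
Proof.
case: sysX => _ _ _ _ [_ _ + _ _] => /(_ i) /leqv_lead h q Aq.
have LuB := lead_add (lead_mul (Lu (ordS i)) (LB (ordS (ordS i))))
  (lead_opp (lead_mul (Lu (ordS (ordS i))) (LB (ordS i)))).
have L2 := lead_mul (lead_mix (sigma_ k) Lphi) (lead_add (LE i) LuB).
by have [+ _] := h _ _ _ _ _ (LJ i) L2; apply.
Qed.

Lemma outer_potential q : A q ->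
  mu 0%N q = hat_lambda k * (phi 0%N q ^+ 3 - phi 0%N q).
Proof.
case: sysX => _ + _ _ _ => /leqv_lead h Aq.
have Lh := lead_fun (fun _ : stime R => hat_lambda k).
have Ll : lead (@lap R C (series_of X Phi)) 0 (laplacian (phi 0%N)) (laplacian (phi 1%N)).
  exact: (lead_lmap (laplacian_cst0 R) Lphi).
have L2 := lead_add
  (lead_lower (-1) (lead_lower 0
    (lead_opp (lead_mul (lead_mul Lh (lead_eps R (stime R))) Ll))))
  (lead_mul (lead_mul Lh (lead_epsV R (stime R)))
    (lead_add (lead_mul (lead_mul Lphi Lphi) Lphi) (lead_opp Lphi))).
have [e _] := h _ _ _ _ _ Lmu L2.
by rewrite e //=; ring.
Qed.

Lemma outer_momentum i q : A q ->
  mu 0%N q * d_x i (phi 0%N) q = 0 /\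
  @mix R K (rho_ k) (phi 0%N) q * d_t (u i 0%N) q
  + \sum_(j < 3) @mix R K (rho_ k) (phi 0%N) q * u j 0%N q * d_x j (u i 0%N) q
  = \sum_(j < 3) d_x j (@stress R K (@mix R K (eta_ k) (phi 0%N))
                          (fun i => u i 0%N) (p 0%N) i j) q
    + (mu 0%N q * d_x i (phi 1%N) q + mu 1%N q * d_x i (phi 0%N) q)
    + @cross R K (fun i => J i 0%N) (fun i => B i 0%N) i q
    + @mix R K (rho_ k) (phi 0%N) q * @gravity R K (grav k) i q.
Proof.
case: sysX => _ _ + _ _ => /(_ i) /leqv_lead h Aq.
have Lrho := lead_mix (rho_ k) Lphi.
have he := lead_eps R (stime R).
(* Here the diffusive flux has order 2 - 1 = 1, so it is absent from the advecting field at order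
   0. *)
have Lm j := lead_lower 0 (lead_opp
  (lead_mul (lead_fun (fun=> (rho_ k true - rho_ k false) / 2))
    (lead_mul (lead_mul (lead_fun (fun=> mob k)) (lead_mul he he)) (Ldx j Lmu)))).
have L1 := lead_lower (-1) (lead_add (lead_mul Lrho (Ldt (Lu i)))
  (lead_sum3 (fun j => lead_mul (lead_add (lead_mul Lrho (Lu j)) (Lm j))
     (Ldx j (Lu i))))).
have LJB := lead_add (lead_mul (LJ (ordS i)) (LB (ordS (ordS i))))
  (lead_opp (lead_mul (LJ (ordS (ordS i))) (LB (ordS i)))).
have Lg := lead_mul Lrho
  (lead_fun (fun _ : stime R => if i == ord_max then - grav k else 0)).
have Ls j := lead_add (lead_mul (lead_mul (lead_fun (fun=> 2)) (lead_mix (eta_ k) Lphi))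
    (lead_mul (lead_fun (fun=> 2^-1)) (lead_add (Ldx j (Lu i)) (Ldx i (Lu j)))))
  (lead_opp (lead_mul (lead_fun (fun=> (i == j)%:R)) Lp)).
have L2 := lead_add (lead_add (lead_add (lead_lower (-1) (lead_sum3 (fun j => Ldx j (Ls j))))
  (lead_mul Lmu (Ldx i Lphi))) (lead_lower (-1) LJB))
  (lead_lower (-1) Lg).
have [e1 e2] := h _ _ _ _ _ L1 L2.
have := e1 _ Aq; have := e2 _ Aq; rewrite /= !addr0 add0r => {}e2 <-.
split=> //; move: e2; under eq_bigr do rewrite addr0.
by move=> ->.
Qed.

End OuterEquations.

(** * Functions of the stretched variable *)

Section RealFunctions.
Context (R : realType).
Implicit Types (f g : R -> R).

Definition has_deriv f f' : Prop := forall z, is_derive z (1 : R) f (f' z).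

Lemma has_deriv_ext f f' g' : has_deriv f f' -> f' =1 g' -> has_deriv f g'.
Proof. by move=> h e z; rewrite -e. Qed.

Lemma has_deriv_cst (c : R) : has_deriv (fun=> c) (fun=> 0).
Proof. by move=> z; exact: is_derive_cst. Qed.

Lemma has_derivD f f' g g' : has_deriv f f' -> has_deriv g g' ->
  has_deriv (fun z => f z + g z) (fun z => f' z + g' z).
Proof. by move=> hf hg z; have := is_deriveD (hf z) (hg z). Qed.

Lemma has_derivN f f' : has_deriv f f' -> has_deriv (fun z => - f z) (fun z => - f' z).
Proof. by move=> hf z; have := is_deriveN (hf z). Qed.

Lemma has_derivM f f' g g' : has_deriv f f' -> has_deriv g g' ->
  has_deriv (fun z => f z * g z) (fun z => f' z * g z + f z * g' z).
Proof.
move=> hf hg z; have := is_deriveM (hf z) (hg z).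
by rewrite /GRing.scale /= addrC [g z * _]mulrC.
Qed.

Lemma has_derivZ (c : R) f f' : has_deriv f f' ->
  has_deriv (fun z => c * f z) (fun z => c * f' z).
Proof.
move=> hf; apply: has_deriv_ext (has_derivM (has_deriv_cst c) hf) _ => z.
by rewrite mul0r add0r.
Qed.

Lemma has_derivX n f f' : has_deriv f f' ->
  has_deriv (fun z => f z ^+ n) (fun z => n%:R * f z ^+ n.-1 * f' z).
Proof. by move=> hf z; have := is_deriveX n (hf z); rewrite exprfctE. Qed.

Lemma has_deriv_sum n (f f' : 'I_n -> R -> R) :
  (forall i, has_deriv (f i) (f' i)) ->
  has_deriv (fun z => \sum_(i < n) f i z) (fun z => \sum_(i < n) f' i z).
Proof.
move=> h z; have := is_derive_sum (fun i => h i z).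
have -> // : \sum_(i < n) f i = (fun z => \sum_(i < n) f i z).
by apply/funext => w; rewrite fct_sumE.
Qed.

Lemma has_deriv_reflect f f' : has_deriv f f' ->
  has_deriv (fun z => f (- z)) (fun z => - f' (- z)).
Proof.
move=> hf z; have hN := is_deriveNid z (1 : R).
have /derivable1_diffP dN : derivable (-%R : R -> R) z 1 by case: hN.
have := hf (- z) => -[/derivable1_diffP df e].
apply: DeriveDef; first exact/derivable1_diffP/differentiable_comp.
rewrite -derive1E (@derive1_comp _ (-%R) f); last 2 first.
- exact/derivable1_diffP.
- exact/derivable1_diffP.
by rewrite !derive1E e (derive_val (is_derive := hN)) mulrN1.
Qed.

Lemma has_deriv_continuous f f' : has_deriv f f' -> continuous f.
Proof.
move=> h z; apply: differentiable_continuous; apply/derivable1_diffP.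
by case: (h z).
Qed.

Lemma has_deriv_MVT f f' (x y : R) : has_deriv f f' -> x <= y ->
  exists2 c, x <= c <= y & f y - f x = f' c * (y - x).
Proof.
move=> h xy; have [|c cxy e] := @MVT_segment _ f f' x y xy (fun z _ => h z).
  exact: continuous_subspaceT (has_deriv_continuous h).
by exists c => //; rewrite in_itv in cxy.
Qed.

Lemma has_deriv0_eq f f' (x y : R) : has_deriv f f' -> (forall z, f' z = 0) -> f x = f y.
Proof. by move=> h f0; apply: is_derive_0_is_cst => z; rewrite -(f0 z). Qed.

Lemma cst_cvg_eq (F : set_system R) {FF : ProperFilter F} f (l : R) :
  (forall x y, f x = f y) -> f z @[z --> F] --> l -> forall x, f x = l.
Proof.
move=> e fl x; have fx : f z @[z --> F] --> f x.
  by rewrite (_ : f = cst (f x)); [exact: cvg_cst | apply/funext => z; exact: e].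
exact: (@norm_cvg_unique _ _ (f z @[z --> F]) _ _ _ fx fl).
Qed.

Lemma has_deriv0_cvg (F : set_system R) {FF : ProperFilter F} f f' (l : R) :
  has_deriv f f' -> (forall z, f' z = 0) -> f z @[z --> F] --> l ->
  forall x, f x = l.
Proof. by move=> h f0; apply: cst_cvg_eq => x y; exact: has_deriv0_eq h f0. Qed.

Lemma continuous_pos f : continuous f -> (forall z, f z != 0) ->
  forall x, 0 < f x -> forall y, 0 < f y.
Proof.
move=> cf f0 x fx y; rewrite lt_def f0 leNgt; apply/negP => fy.
have [xy|/ltW xy] := leP x y.
  have [|c _ fc] := @IVT _ f x y 0 xy (continuous_subspaceT cf).
    by rewrite ge_min le_max (ltW fx) (ltW fy) orbT.
  by have := f0 c; rewrite fc eqxx.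
have [|c _ fc] := @IVT _ f y x 0 xy (continuous_subspaceT cf).
  by rewrite ge_min le_max (ltW fx) (ltW fy) orbT.
by have := f0 c; rewrite fc eqxx.
Qed.

(** With [M] the maximum of [b] between [x] and a point on its right, the product of [y^2] and
    [expR (- 2 M z)] cannot increase from its value 0 at [x]. The left side follows by
    reflection. *)
Lemma gronwall_zero (y y' b : R -> R) (x : R) : has_deriv y y' -> continuous b ->
  (forall z, `|y' z| <= b z * `|y z|) -> y x = 0 -> forall z, y z = 0.
Proof.
have right (y0 y0' b0 : R -> R) (x0 z0 : R) : has_deriv y0 y0' -> continuous b0 ->
    (forall z, `|y0' z| <= b0 z * `|y0 z|) -> y0 x0 = 0 -> x0 <= z0 -> y0 z0 = 0.
  move=> hy cb yb yx xz.
  have [c _ bM] := EVT_max xz (continuous_subspaceT cb).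
  pose M := b0 c.
  have he : has_deriv (fun z => expR (- (2 * M) * z))
      (fun z => - (2 * M) * expR (- (2 * M) * z)).
    move=> z; have hl : is_derive z (1 : R) (fun z => - (2 * M) * z) (- (2 * M)).
      have hid : has_deriv (fun z => z) (fun=> 1) by move=> w; exact: is_derive_id.
      by have := has_derivZ (- (2 * M)) hid z; rewrite mulr1.
    have [/derivable1_diffP dl el] := hl.
    have [/derivable1_diffP de ee] := is_derive_expR (- (2 * M) * z).
    apply: DeriveDef; first exact/derivable1_diffP/(differentiable_comp dl de).
    rewrite -derive1E (@derive1_comp _ (fun z => - (2 * M) * z) expR); last 2 first.
    - exact/derivable1_diffP.
    - exact/derivable1_diffP.
    by rewrite !derive1E ee el mulrC.
  have hG := has_derivM (has_derivX 2 hy) he.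
  have [w wxz] := has_deriv_MVT hG xz.
  rewrite /= yx expr0n /= mul0r subr0 expr1 => e.
  have e0 z : 0 < expR (- (2 * M) * z) := expR_gt0 _.
  have d0 : 2 * y0 w * y0' w * expR (- (2 * M) * w)
      + y0 w ^+ 2 * (- (2 * M) * expR (- (2 * M) * w)) <= 0.
    have -> : 2 * y0 w * y0' w * expR (- (2 * M) * w)
      + y0 w ^+ 2 * (- (2 * M) * expR (- (2 * M) * w))
      = 2 * (y0 w * y0' w - M * y0 w ^+ 2) * expR (- (2 * M) * w) by ring.
    rewrite pmulr_lle0 // pmulr_rle0 // subr_le0.
    rewrite (le_trans (ler_norm _)) // normrM -real_normK ?num_real //.
    rewrite mulrC expr2 mulrA ler_wpM2r //.
    by apply: le_trans (yb w) _; rewrite ler_wpM2r // bM // in_itv.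
  have : y0 z0 ^+ 2 * expR (- (2 * M) * z0) <= 0.
    by rewrite e mulr_le0_ge0 // subr_ge0.
  by rewrite pmulr_lle0 // => h; apply/eqP; rewrite -sqrf_eq0 eq_le h sqr_ge0.
move=> hy cb yb yx z; have [xz|/ltW xz] := leP x z; first exact: right hy cb yb yx xz.
have := right (fun z => y (- z)) (fun z => - y' (- z)) (fun z => b (- z)) (- x) (- z).
rewrite !opprK lerN2; apply => //.
- exact: has_deriv_reflect.
- move=> w; apply: continuous_comp; [exact: opp_continuous|exact: cb].
- by move=> w; rewrite normrN.
Qed.

End RealFunctions.

(** * The heteroclinic profile and its decay *)

Section Profile.
Context (R : realType).
Implicit Types (f g : R -> R).

Lemma cvg0_of_sqr_le (F : set_system R) {FF : Filter F} f : 
  (forall e, 0 < e -> \forall z \near F, f z ^+ 2 <= e) -> f z @[z --> F] --> (0 : R).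
Proof.
move=> h; apply/cvgrPdist_le => e e0; near=> z.
rewrite sub0r normrN -(@ler_pXn2r _ 2) ?nnegrE ?(ltW e0) // real_normK ?num_real //.
by near: z; apply: h; rewrite exprn_gt0.
Unshelve. all: by end_near. Qed.

(* Once |g'| <= beta / 4 and b >= beta / 2, the function (g^2 + 1) f is
   nonincreasing; hence (g f)^2 = O(f). *)
Lemma slow_mul_decaying f g g' (b : R -> R) (beta : R) : 0 < beta ->
  (forall z, 0 < f z) -> has_deriv f (fun z => - b z * f z) -> has_deriv g g' ->
  b z @[z --> +oo] --> beta -> g' z @[z --> +oo] --> (0 : R) ->
  f z @[z --> +oo] --> (0 : R) -> g z * f z @[z --> +oo] --> (0 : R).
Proof.
move=> beta0 f0 df dg /cvgrPdist_le hb /cvgrPdist_le hg' /cvgrPdist_le hf.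
have hG := has_derivM (has_derivD (has_derivX 2 dg) (has_deriv_cst 1)) df.
have b2 : 0 < beta / 2 by rewrite divr_gt0.
have b4 : 0 < beta / 4 by rewrite divr_gt0.
have [z0 [_ h0]] : \forall z \near +oo, beta / 2 <= b z /\ `|g' z| <= beta / 4.
  near=> z; split.
    have : `|beta - b z| <= beta / 2 by near: z; exact: hb.
    by rewrite ler_norml => /andP[_]; lra.
  rewrite -normrN -sub0r; near: z; exact: hg'.
(* The neighbourhoods of [+oo] are given by open half-lines, so [h0] holds strictly beyond [z0];
   hence the starting point [z0 + 1]. *)
pose K := (g (z0 + 1) ^+ 2 + 1) * f (z0 + 1).
have K0 : 0 < K by rewrite mulr_gt0 // ltr_wpDl ?sqr_ge0.
have bound z : z0 + 1 <= z -> (g z ^+ 2 + 1) * f z <= K.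
  move=> z0z; have [w /andP[w0 _] e] := has_deriv_MVT hG z0z.
  rewrite -subr_le0 /K e mulr_le0_ge0 ?subr_ge0 //.
  have [|bw gw] := h0 w; first by apply: lt_le_trans w0; rewrite ltrDl.
  rewrite addr0 /= expr1.
  rewrite (_ : _ + _ = (2 * (g w * g' w) - b w * (g w ^+ 2 + 1)) * f w); last by ring.
  rewrite pmulr_lle0 // subr_le0.
  have gg : g w * g' w <= `|g w| * (beta / 4).
    by rewrite (le_trans (ler_norm _)) // normrM ler_wpM2l.
  have g2 : `|g w| * 2 <= g w ^+ 2 + 1.
    by rewrite -(real_normK (num_real (g w))); have := sqr_ge0 (`|g w| - 1); nra.
  have : beta / 2 * (g w ^+ 2 + 1) <= b w * (g w ^+ 2 + 1).
    by rewrite ler_wpM2r // addr_ge0 ?sqr_ge0.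
  have : beta / 4 * (`|g w| * 2) <= beta / 4 * (g w ^+ 2 + 1) by rewrite ler_wpM2l // ltW.
  have : 0 <= beta / 4 * (g w ^+ 2 + 1) by rewrite mulr_ge0 ?addr_ge0 ?sqr_ge0 // ltW.
  by move=> *; lra.
apply: cvg0_of_sqr_le => e e0.
near=> z.
have zz : z0 + 1 <= z by near: z; apply: nbhs_pinfty_ge; rewrite num_real.
have fz : f z <= e / K.
  apply: le_trans (ler_norm _) _; rewrite -normrN -sub0r; near: z; apply: hf.
  by rewrite divr_gt0.
rewrite exprMn expr2 mulrA; apply: (@le_trans _ _ (K * f z)).
  rewrite ler_wpM2r ?(ltW (f0 _)) //; apply: le_trans (bound _ zz).
  by rewrite ler_wpM2r ?(ltW (f0 _)) // lerDl.
by rewrite mulrC -ler_pdivlMr.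
Unshelve. all: by end_near. Qed.

Lemma slow_mul_decayingNy f g g' (b : R -> R) (beta : R) : 0 < beta ->
  (forall z, 0 < f z) -> has_deriv f (fun z => b z * f z) -> has_deriv g g' ->
  b z @[z --> -oo] --> beta -> g' z @[z --> -oo] --> (0 : R) ->
  f z @[z --> -oo] --> (0 : R) -> g z * f z @[z --> -oo] --> (0 : R).
Proof.
move=> beta0 f0 /has_deriv_reflect df /has_deriv_reflect dg.
move=> /cvgNy_compNP hb /cvgNy_compNP hg' /cvgNy_compNP hf; apply/cvgNy_compNP.
apply: (@slow_mul_decaying (f \o -%R) (g \o -%R) _ (b \o -%R) beta) dg _ _ _ => //.
- by move=> z; exact: f0.
- by apply: has_deriv_ext df _ => z /=; rewrite mulNr.
- by rewrite -oppr0; apply: cvgN.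
Qed.

Section HeteroclinicProfile.
Variables (phi psi : R -> R).
Hypotheses (dphi : has_deriv phi psi) (dpsi : has_deriv psi (fun z => phi z ^+ 3 - phi z)).
Hypotheses (phi_y : phi z @[z --> +oo] --> (1 : R)).
Hypotheses (phi_Ny : phi z @[z --> -oo] --> (-1 : R)).
Hypothesis (psi_y : psi z @[z --> +oo] --> (0 : R)).

(** Conservation of energy for phi'' = phi^3 - phi; the limits at [+oo] make the constant of
    integration zero. *)
Let energy z : psi z ^+ 2 = (1 - phi z ^+ 2) ^+ 2 / 2.
Proof.
have h1 : has_deriv (fun z => 1 - phi z ^+ 2) (fun z => - (2 * phi z * psi z)).
  apply: has_deriv_ext (has_derivD (has_deriv_cst 1) (has_derivN (has_derivX 2 dphi))) _ => w.
  by rewrite add0r expr1.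
have h := has_derivD (has_derivX 2 dpsi) (has_derivN (has_derivZ 2^-1 (has_derivX 2 h1))).
have := @has_deriv0_cvg _ +oo _ _ _ 0 h _ _ z.
move=> h0; apply/eqP; rewrite -subr_eq0 [_ / 2]mulrC h0 //.
  by move=> w /=; field.
rewrite (_ : 0 = 0 ^+ 2 + - (2^-1 * (1 - 1 ^+ 2) ^+ 2) :> R); last by ring.
apply: cvgD; first by rewrite !expr2; apply: cvgM.
apply: cvgN; apply: cvgM; first exact: cvg_cst.
have c : 1 - phi z ^+ 2 @[z --> +oo] --> (1 - 1 ^+ 2 : R).
  apply: cvgB; first exact: cvg_cst.
  by rewrite [1 ^+ 2]expr2; under eq_cvg do rewrite expr2; apply: cvgM.
by rewrite [(1 - 1 ^+ 2) ^+ 2]expr2; under eq_cvg do rewrite expr2; apply: cvgM.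
Qed.

Let sign_change : exists ab : R * R, [/\ ab.1 < ab.2, phi ab.1 < 0 & 0 < phi ab.2].
Proof.
have [b [b0 hb]] : exists b, 0 < b /\ 0 < phi b.
  apply: (@filter_ex _ (+oo : set_system R)); near=> z; split.
    by near: z; apply: nbhs_pinfty_gt; rewrite num_real.
  have : `|1 - phi z| <= 2^-1 by near: z; move/cvgrPdist_le: phi_y; apply; rewrite invr_gt0.
  by rewrite ler_norml => /andP[_]; lra.
have [a [a0 ha]] : exists a, a < 0 /\ phi a < 0.
  apply: (@filter_ex _ (-oo : set_system R)); near=> z; split.
    by near: z; apply: nbhs_ninfty_lt; rewrite num_real.
  have : `|-1 - phi z| <= 2^-1 by near: z; move/cvgrPdist_le: phi_Ny; apply; rewrite invr_gt0.
  by rewrite ler_norml => /andP[+ _]; lra.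
by exists (a, b); split=> //=; lra.
Unshelve. all: by end_near. Qed.

(** By the energy identity, y = 1 - phi^2 satisfies |y'| = sqrt 2 |phi| |y|. A zero of y would make
    it vanish identically by [gronwall_zero], whereas y = 1 at a zero of phi; so y keeps the sign it
    has there. *)
Lemma profile_lt1 z : 0 < 1 - phi z ^+ 2.
Proof.
have cphi := has_deriv_continuous dphi.
have h1 : has_deriv (fun z => 1 - phi z ^+ 2) (fun z => - (2 * phi z * psi z)).
  apply: has_deriv_ext (has_derivD (has_deriv_cst 1) (has_derivN (has_derivX 2 dphi))) _ => w.
  by rewrite add0r expr1.
have [[a b] /= [ab pa pb]] := sign_change.
have [|c _ pc] := @IVT _ phi a b 0 (ltW ab) (continuous_subspaceT cphi).
  by rewrite ge_min le_max (ltW pa) (ltW pb) orbT.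
apply: (@continuous_pos _ (fun z => 1 - phi z ^+ 2) (has_deriv_continuous h1) _ c); last first.
  by rewrite pc expr0n subr0.
move=> w; apply/eqP => w0.
have h2 : has_deriv (fun z => 1 + phi z ^+ 2) _ := has_derivD (has_deriv_cst 1) (has_derivX 2 dphi).
have := @gronwall_zero _ _ _ (fun z => 1 + phi z ^+ 2) w h1 (has_deriv_continuous h2) _ w0 c.
rewrite pc expr0n subr0 => one0.
suff /one0/eqP : forall z, `|- (2 * phi z * psi z)| <= (1 + phi z ^+ 2) * `|1 - phi z ^+ 2|.
  by rewrite oner_eq0.
(* Squaring removes the root and the absolute values: what remains is 2 phi^2 <= (1 + phi^2)^2. *)
move=> v; rewrite normrN -(@ler_pXn2r _ 2) ?nnegrE ?mulr_ge0 ?addr_ge0 ?sqr_ge0 //.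
rewrite exprMn !real_normK ?num_real // exprMn energy.
have := sqr_ge0 (1 - phi v ^+ 2); have := sqr_ge0 (phi v ^+ 2 ); have := sqr_ge0 (1 : R).
set s := (1 - _) ^+ 2; move=> _ _ s0.
rewrite (_ : _ * (s / 2) = 2 * phi v ^+ 2 * s); last by rewrite exprMn; field.
by rewrite ler_wpM2r //; have := sqr_ge0 (phi v ^+ 2); nra.
Qed.

(** The energy determines psi up to sign. Since 1 - phi^2 > 0, psi has no zero, and its constant
    sign is read off from a mean slope between a negative and a positive value of phi. *)
Lemma profile_derivative z : psi z = (1 - phi z ^+ 2) / Num.sqrt 2.
Proof.
have s2 : 0 < Num.sqrt 2 :> R by rewrite sqrtr_gt0.
have [[a b] /= [ab pa pb]] := sign_change.
have [c _ ec] := has_deriv_MVT dphi (ltW ab).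
have pc : 0 < psi c.
  have : 0 < psi c * (b - a) by rewrite -ec subr_gt0 (lt_trans pa).
  by rewrite pmulr_lgt0 // subr_gt0.
have psi0 w : psi w != 0.
  by rewrite -sqrf_eq0 energy gt_eqF // divr_gt0 // exprn_gt0 // profile_lt1.
have pz := continuous_pos (has_deriv_continuous dpsi) psi0 pc z.
apply/eqP; rewrite -(@eqrXn2 _ 2) ?(ltW pz) //; last by rewrite ltW // divr_gt0 // profile_lt1.
by rewrite energy expr_div_n sqr_sqrtr.
Qed.

End HeteroclinicProfile.
End Profile.

(** * Geometry of the interface *)

Section TangentialDerivative.
Context (R : realType) (V : normedModType R).

Lemma differentiable_bound (f : V -> R) (p : V) (e : R) : differentiable f p -> 0 < e ->
  \forall h \near (0 : V), `|f (p + h) - f p - 'd f p h| <= e * `|h|.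
Proof.
move=> /diff_locally df e0.
have /eqaddoP/(_ _ e0) := df.
apply: filterS => h hh.
have -> : f (p + h) - f p - 'd f p h = f (h + p) - (f p + 'd f p h).
  by rewrite [p + h]addrC opprD addrA.
exact: hh.
Qed.

(* Instead of a curve of zeros of d tangent to tau, the intermediate value theorem
   gives, for small s, a zero of d of the form p + s (tau + c nu) with |c| <= e. *)
Lemma differentiable_tangent (d F : V -> R) (p tau nu : V) :
  differentiable d p -> differentiable F p ->
  (\forall q \near p, {for q, continuous d}) ->
  (\forall q \near p, d q = 0 -> F q = 0) ->
  d p = 0 -> 'd d p nu = 1 -> 'd d p tau = 0 -> 'd F p tau = 0.
Proof.
move=> dd dF cd dF0 dp dnu dtau; have Fp : F p = 0 by exact: (nbhs_singleton dF0).
suff main (e : R) : 0 < e -> `|'d F p tau| <= e * (`|'d F p nu| + 1).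
  apply/eqP; rewrite -normr_le0; apply/ler_addgt0Pl => e e0; rewrite addr0.
  have N0 : 0 < `|'d F p nu| + 1 by rewrite ltr_wpDl.
  by have := main (e / (`|'d F p nu| + 1)) (divr_gt0 e0 N0); rewrite divfK // gt_eqF.
(* [K] bounds the norm of tau + c nu for |c| <= e. With the tolerance [e / (2 * K)] the error at
   [H c] is at most s e / 2, half the size of the linear part s c of d at c = e and c = -e; hence d
   changes sign between these two values. *)
move=> e0; pose K := `|tau| + e * `|nu| + 1.
have K0 : 0 < K by rewrite ltr_wpDl // addr_ge0 // mulr_ge0 // ltW.
have e'0 : 0 < e / (2 * K) by rewrite divr_gt0 // mulr_gt0.
pose good h := [/\ `|d (p + h) - d p - 'd d p h| <= e / (2 * K) * `|h|,
  `|F (p + h) - F p - 'd F p h| <= e / (2 * K) * `|h|,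
  {for p + h, continuous d} & d (p + h) = 0 -> F (p + h) = 0].
have [del del0 hdel] : exists2 del : R, 0 < del & forall h : V, `|h| < del -> good h.
  have sh (P : V -> Prop) : (\forall q \near p, P q) -> \forall h \near (0 : V), P (p + h).
    rewrite -{1}[p]addr0 => hP.
    have : (fun h => p + h) @ (0 : V) --> p + 0 by apply: cvgD; [exact: cvg_cst|exact: cvg_id].
    by move=> /(_ _ hP).
  have : \forall h \near (0 : V), good h.
    have n1 := differentiable_bound dd e'0; have n2 := differentiable_bound dF e'0.
    have n3 := sh _ cd; have n4 := sh _ dF0.
    near=> h; have h1 := near n1 h; have h2 := near n2 h; have h3 := near n3 h.
    have h4 := near n4 h; split; [exact: h1|exact: h2|exact: h3|exact: h4].
  move=> /nbhs_ballP[del /= del0 hb]; exists del => // h hh; apply: hb.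
  by rewrite -ball_normE /= sub0r normrN.
pose s := del / (2 * K).
have s0 : 0 < s by rewrite divr_gt0 // mulr_gt0.
pose H c := s *: (tau + c *: nu).
have HK c : `|c| <= e -> `|H c| <= s * K.
  move=> ce; rewrite normrZ gtr0_norm // ler_pM2l //.
  rewrite (le_trans (ler_normD _ _)) // normrZ /K -addrA lerD2l.
  by rewrite (@le_trans _ _ (e * `|nu|)) ?ler_wpM2r // lerDl.
have Hdel c : `|c| <= e -> `|H c| < del.
  move=> /HK /le_lt_trans; apply; rewrite /s invfM mulrA mulfVK ?gt_eqF //.
  by rewrite ltr_pdivrMr // ltr_pMr // ltr1n.
have Hbound c : `|c| <= e -> e / (2 * K) * `|H c| <= s * e / 2.
  move=> /HK h; rewrite (le_trans (ler_wpM2l (ltW e'0) h)) //.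
  by rewrite le_eqVlt; apply/orP; left; apply/eqP; field; rewrite gt_eqF.
have dH c : 'd d p (H c) = s * c.
  by rewrite /H linearZ linearD linearZ /= dnu dtau add0r [c *: _]mulr1.
have FH c : 'd F p (H c) = s * ('d F p tau + c * 'd F p nu).
  by rewrite /H linearZ linearD linearZ.
have se : 0 < s * e by rewrite mulr_gt0.
have ee : `|e| <= e by rewrite gtr0_norm.
have eNe : `|- e| <= e by rewrite normrN.
have [|||c cI gc] := @IVT _ (fun c => d (p + H c)) (- e) e 0.
- by rewrite (le_trans _ (ltW e0)) // oppr_le0 ltW.
- apply: continuous_in_subspaceT => c; rewrite inE /= in_itv /= => ce.
  have {}ce : `|c| <= e by rewrite ler_norml.
  have [_ _ cdc _] := hdel _ (Hdel c ce).
  apply: (@continuous_comp _ _ _ (fun c => p + H c) d) => //.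
  apply: cvgD; first exact: cvg_cst.
  apply: cvgZr; apply: cvgD; first exact: cvg_cst.
  by apply: cvgZl; exact: cvg_id.
- have [h1 _ _ _] := hdel _ (Hdel e ee).
  have [h2 _ _ _] := hdel _ (Hdel (- e) eNe).
  move: (le_trans h1 (Hbound e ee)); rewrite dH dp subr0 ler_norml => /andP[+ _].
  move: (le_trans h2 (Hbound (- e) eNe)).
  rewrite dH dp subr0 ler_norml mulrN => /andP[_ a2] a1.
  by rewrite ge_min le_max; apply/andP; split; apply/orP; [left|right]; lra.
have {}cI : `|c| <= e by rewrite ler_norml; move: cI; rewrite in_itv.
have [_ hF _ hF0] := hdel _ (Hdel c cI).
move: (le_trans hF (Hbound c cI)); rewrite (hF0 gc) Fp subr0 sub0r normrN FH.
rewrite normrM gtr0_norm // -mulrA ler_pM2l // => hh.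
rewrite -(addrK (c * 'd F p nu) ('d F p tau)) (le_trans (ler_normB _ _)) //.
rewrite normrM mulrDr mulr1 addrC lerD // ?ler_wpM2r //.
by rewrite (le_trans hh) // ler_pdivrMr // ler_pMr // ler1n.
Unshelve. all: by end_near. Qed.

End TangentialDerivative.

Section Distance.
Context (R : realType).
Implicit Types (x y : 'rV[R]_3) (A : set 'rV[R]_3).

Lemma enorm_ge0 x : 0 <= enorm x.
Proof. exact: sqrtr_ge0. Qed.

(** The topology of row vectors comes from the maximum norm, the interface distance from the
    Euclidean one; this comparison links the two. *)
Lemma norm_le_enorm x : `|x| <= enorm x.
Proof.
have [->|] := eqVneq `|x| 0; first exact: enorm_ge0.
move=> /mx_norm_neq0[[i j]] /= e; rewrite [`|x|]e (ord1 i) /enorm -sqrtr_sqr ler_wsqrtr //.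
by rewrite (bigD1 j) //= lerDl sumr_ge0 // => l _; exact: sqr_ge0.
Qed.

Lemma edist_ge0 x A : A !=set0 -> 0 <= Defs.edist x A.
Proof.
move=> [y Ay]; apply: lb_le_inf; first by exists (enorm (x - y)), y.
by move=> _ [z _ <-]; exact: enorm_ge0.
Qed.

Lemma edist_mem x A : A x -> Defs.edist x A = 0.
Proof.
move=> Ax; apply/eqP; rewrite eq_le edist_ge0 ?andbT; last by exists x.
apply: ge_inf; first by exists 0 => _ [z _ <-]; exact: enorm_ge0.
exists x => //; rewrite subrr /enorm big1 ?sqrtr0 // => i _.
by rewrite mxE expr0n.
Qed.

Lemma edist_eq0 x A : A !=set0 -> closed A -> Defs.edist x A = 0 -> A x.
Proof.
move=> A0 cA d0; apply: contrapT => nAx.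
have /nbhs_ballP[e /= e0 hb] : nbhs x (~` A).
  by apply: open_nbhs_nbhs; split=> //; exact: closed_openC.
have : e <= Defs.edist x A.
  apply: lb_le_inf; first by case: A0 => y Ay; exists (enorm (x - y)), y.
  move=> _ [y Ay <-]; apply: le_trans (norm_le_enorm _); rewrite leNgt; apply/negP => xy.
  by apply: (hb y) => //; rewrite -ball_normE.
by rewrite d0 leNgt e0.
Qed.

End Distance.

Lemma nbhs_slice (R : realType) (P : set (stime R)) (t : R) (x : 'rV[R]_3) :
  nbhs ((t, x) : stime R) P -> \forall y \near x, P (t, y).
Proof.
have cp : ((t, y) : stime R) @[y --> x] --> ((t, x) : stime R).
  apply: (@cvg_pair _ _ _ (nbhs x) (nbhs t) (nbhs x) _ _ _ (fun=> t) id).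
    exact: cvg_cst.
  exact: cvg_id.
exact: cp.
Qed.

Section Interface.
Context (R : realType) (T : R) (Omega : set (vec R)).
Variables (Om : bool -> R -> set (vec R)) (Gam : R -> set (vec R)).
Hypothesis hGam : evolving_interface T Omega Om Gam.
Local Notation d := (sdist Om Gam).
Implicit Types (q : stime R).

Lemma Gam_neq0 t : 0 < t < T -> Gam t !=set0.
Proof. by case: hGam => h _ _ _ /h[]. Qed.

Lemma Gam_closed t : 0 < t < T -> closed (Gam t).
Proof.
case: hGam => h _ _ _ /h[_ _ _ cG _]; have H : hausdorff_space 'rV[R]_3 by exact: norm_hausdorff.
exact: (compact_closed H cG).
Qed.

Lemma Om_open s t : 0 < t < T -> open (Om s t).
Proof.
move=> tT; case: hGam => _ /(_ s) oS _ _.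
rewrite openE => x Ox; rewrite /interior.
have oxt : nbhs ((t, x) : stime R) (sweep T (Om s)) by apply: open_nbhs_nbhs; split.
by apply: filterS (nbhs_slice oxt) => y [_].
Qed.

Lemma sdist_gt0 q : 0 < q.1 < T -> 0 < d q -> Om true q.1 q.2.
Proof.
move=> qT; rewrite /sdist; case: ifPn => [/set_mem//|_].
by rewrite oppr_gt0 ltNge edist_ge0 //; exact: Gam_neq0.
Qed.

Lemma sdist_Gam q : Gam q.1 q.2 -> d q = 0.
Proof. by move=> Gq; rewrite /sdist edist_mem // oppr0 if_same. Qed.

Lemma sdist_eq0 q : 0 < q.1 < T -> d q = 0 -> Gam q.1 q.2.
Proof.
move=> qT; rewrite /sdist => dq; apply: edist_eq0; [exact: Gam_neq0|exact: Gam_closed|].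
by move: dq; case: ifP => // _ /eqP; rewrite oppr_eq0 => /eqP.
Qed.

(** The signed distance is negative outside [Omega] as well, whence the assumption [Omega q.2]. *)
Lemma sdist_lt0 q : 0 < q.1 < T -> Omega q.2 -> d q < 0 -> Om false q.1 q.2.
Proof.
move=> qT Oq dq; have [e _ _ _ _] : _ := let: And4 h _ _ _ := hGam in h q.1 qT.
move: Oq; rewrite e => -[[ot|og]|//].
  by move: dq; rewrite /sdist mem_set // ltNge edist_ge0 //; exact: Gam_neq0.
by move: dq; rewrite sdist_Gam // ltxx.
Qed.

Lemma sdist_nbhs q : sweep T Gam q ->
  \forall q' \near q, forall vs, differentiable (foldr (@Defs.deriv R _) d vs) q'.
Proof.
case: hGam => _ _ [N [oN GN dN]] _ Gq.
apply: (@filterS _ _ _ N); first by move=> q' Nq' vs; exact: dN.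
by apply: open_nbhs_nbhs; split => //; exact: GN.
Qed.

Lemma sdist_differentiable q : sweep T Gam q -> differentiable d q.
Proof. by move=> /sdist_nbhs/nbhs_singleton/(_ [::]). Qed.

Lemma normal_differentiable i q : sweep T Gam q -> differentiable (normal d i) q.
Proof. by move=> /sdist_nbhs/nbhs_singleton/(_ [:: (0, ev R i)]). Qed.

Lemma sweep_near q (A : R -> set (vec R)) : sweep T A q -> \forall q' \near q, 0 < q'.1 < T.
Proof.
move=> [qT _]; have o : open [set t : R | 0 < t < T].
  rewrite (_ : mkset _ = `]0, T[%classic); first exact: itv_open.
  by apply/seteqP; split => t /=; rewrite in_itv.
have : nbhs q.1 [set t : R | 0 < t < T] by apply: open_nbhs_nbhs.
by case: q qT => t x /= _ h; exact: (@cvg_fst _ _ (nbhs t) (nbhs x) _ _ h).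
Qed.

Lemma sum_normal_sqr q : sweep T Gam q -> \sum_(i < 3) normal d i q * normal d i q = 1.
Proof.
case: hGam => _ _ _ h /h; rewrite /enorm => e.
have := congr1 (fun x => x ^+ 2) e; rewrite sqr_sqrtr ?expr1n => [<-|].
  by apply: eq_bigr => i _; rewrite mxE expr2.
by rewrite sumr_ge0 // => i _; exact: sqr_ge0.
Qed.

End Interface.

Section DirectionalDerivatives.
Context (R : realType).

Lemma diff_stime (f : stime R -> R) q (v : 'rV[R]_3) : differentiable f q ->
  'd f q (0, v) = \sum_(i < 3) v 0 i * d_x i f q.
Proof.
move=> df; rewrite {1}[v]row_sum_delta.
have addE (a b : 'rV[R]_3) : ((0, a + b) : stime R) = (0, a) + (0, b).
  by do ?apply: injective_projections; rewrite /= ?addr0.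
have scaleE (c : R) (a : 'rV[R]_3) : ((0, c *: a) : stime R) = c *: ((0, a) : stime R).
  by do ?apply: injective_projections; rewrite /= ?scaler0.
have -> : ((0, \sum_(j < 3) v 0 j *: 'e_j) : stime R)
    = \sum_(j < 3) v 0 j *: ((0, ev R j) : stime R).
  by rewrite !big_ord_recl !big_ord0 !addr0 !addE !scaleE.
rewrite linear_sum; apply: eq_bigr => i _.
by rewrite linearZ /d_x /Defs.deriv deriveE.
Qed.

Lemma diff_istime (f : istime R -> R) p (v : 'rV[R]_3) : differentiable f p ->
  'd f p (0, v, 0) = \sum_(i < 3) v 0 i * di_x i f p.
Proof.
move=> df; rewrite {1}[v]row_sum_delta.
have addE (a b : 'rV[R]_3) : ((0, a + b, 0) : istime R) = (0, a, 0) + (0, b, 0).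
  by do ?apply: injective_projections; rewrite /= ?addr0.
have scaleE (c : R) (a : 'rV[R]_3) : ((0, c *: a, 0) : istime R) = c *: ((0, a, 0) : istime R).
  by do ?apply: injective_projections; rewrite /= ?scaler0.
have -> : ((0, \sum_(j < 3) v 0 j *: 'e_j, 0) : istime R)
    = \sum_(j < 3) v 0 j *: ((0, ev R j, 0) : istime R).
  by rewrite !big_ord_recl !big_ord0 !addr0 !addE !scaleE.
rewrite linear_sum; apply: eq_bigr => i _.
by rewrite linearZ /di_x /Defs.deriv deriveE.
Qed.

End DirectionalDerivatives.

Lemma is_derive_line (R : realType) (V : normedModType R) (f : V -> R) (p v : V) (c : R) :
  derivable f (p + c *: v) v ->
  is_derive c (1 : R) (fun c => f (p + c *: v)) ('D_v f (p + c *: v)).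
Proof.
move=> df; pose quot := fun h : R => h^-1 *: ((f \o shift (p + c *: v)) (h *: v) - f (p + c *: v)).
have e : (fun h : R => h^-1 *: (((fun c => f (p + c *: v)) \o shift c) (h *: 1)
    - f (p + c *: v))) = quot.
  apply/funext => h; rewrite /quot /shift /= (_ : h *: (1 : R) = h); last exact: mulr1.
  by rewrite scalerDl addrCA.
by apply: DeriveDef; [rewrite /derivable e | rewrite /derive e].
Qed.

Lemma scaler_cvg0 (R : realType) (V : normedModType R) (w : V) :
  c *: w @[c --> 0^'+] --> (0 : V).
Proof.
rewrite -[X in _ --> X](scale0r w); apply: cvgZl.
by apply: cvg_within_filter; exact: cvg_id.
Qed.

Section InterfaceNeighbourhood.
Context (R : realType) (T : R) (Omega : set (vec R)).
Variables (Om : bool -> R -> set (vec R)) (Gam : R -> set (vec R)).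
Hypothesis hGam : evolving_interface T Omega Om Gam.
Local Notation d := (sdist Om Gam).
Implicit Types (q : stime R).

Lemma fst_differentiable (p : istime R) : differentiable (fst : istime R -> stime R) p.
Proof.
apply: linear_differentiable => -[a b].
exact: (@cvg_fst _ _ (nbhs a) (nbhs b) (@nbhs_filter _ b)).
Qed.

Lemma differentiable_fst_comp (f : stime R -> R) (p : istime R) :
  differentiable f p.1 -> differentiable (fun p : istime R => f p.1) p.
Proof.
move=> df; apply: (@differentiable_comp _ _ _ _ (fst : istime R -> stime R) f) => //.
exact: fst_differentiable.
Qed.

(** [surf_grad d i F] is the differential of [F] along e_i - n_i n, a vector annihilated by the
    differential of the signed distance. Near [p] the zeros of the distance are interface points, so
    [differentiable_tangent] applies with n as the transversal direction. *)
Lemma surf_grad_eq0 (F : istime R -> R) (p : istime R) i : sweep_inner T Gam p ->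
  differentiable F p -> (forall p', sweep_inner T Gam p' -> F p' = 0) ->
  surf_grad d i F p = 0.
Proof.
move=> Gp dF F0; pose q : stime R := p.1.
have Gq : sweep T Gam q by [].
pose v := ev R i - normal d i q *: normal_vec d q.
have vE j : v 0 j = (j == i)%:R - normal d i q * normal d j q.
  by rewrite !mxE eqxx.
pose D := fun p : istime R => d p.1.
have dD : differentiable D p.
  exact: differentiable_fst_comp (sdist_differentiable hGam Gq).
have DE j : di_x j D p = normal d j q by [].
have -> : surf_grad d i F p = 'd F p ((0, v, 0) : istime R).
  rewrite (diff_istime v dF) /surf_grad /=.
  under [RHS]eq_bigr do rewrite vE mulrBl.
  rewrite sumrB; congr (_ - _).
    rewrite (bigD1 i) //= eqxx mul1r big1 ?addr0 // => j /negPf ->.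
    by rewrite mul0r.
  by rewrite mulr_sumr; apply: eq_bigr => j _; rewrite mulrA.
have near1 : \forall p' \near p, {for p', continuous D} /\ 0 < p'.1.1 < T.
  have h : \forall q' \near q, differentiable d q' /\ 0 < q'.1 < T.
    near=> q'; split.
      by have := near (sdist_nbhs hGam Gq) q' => /(_ _ [::]); apply.
    by near: q'; exact: sweep_near Gq.
  have hp := differentiable_continuous (fst_differentiable p) h.
  near=> p'; have [c1 c2] : differentiable d p'.1 /\ 0 < p'.1.1 < T by near: p'; exact: hp.
  split=> //.
  by apply: differentiable_continuous; exact: differentiable_fst_comp.
apply: (@differentiable_tangent _ _ D F p _ ((0, normal_vec d q, 0) : istime R)) => //.
- by apply: filterS near1 => p' [].
- apply: filterS near1 => -[q' z'] [_ /= qT] D0; apply: F0; split=> //.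
  exact: (sdist_eq0 hGam).
- by apply: sdist_Gam; case: Gq.
- rewrite (diff_istime _ dD) -(sum_normal_sqr hGam Gq).
  by apply: eq_bigr => j _; rewrite DE mxE.
- rewrite (diff_istime _ dD); under eq_bigr do rewrite DE vE mulrBl.
  rewrite sumrB (bigD1 i) //= eqxx mul1r big1 => [|j /negPf ->]; last by rewrite mul0r.
  under eq_bigr do rewrite -mulrA.
  by rewrite -mulr_sumr (sum_normal_sqr hGam Gq) mulr1 addr0 subrr.
Unshelve. all: by end_near. Qed.

Definition side (s : bool) : R := if s then 1 else -1.

(** On the ray, the signed distance is [side s * c] up to an error of c / 2, so its sign is known,
    and inside [Omega] this sign identifies the phase. *)
Lemma normal_ray q s : open Omega -> sweep T Gam q ->
  \forall c \near 0^'+, Om s q.1 (q.2 + (side s * c) *: normal_vec d q).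
Proof.
move=> oO Gq; have dd := sdist_differentiable hGam Gq; have [qT Gq2] := Gq.
pose n := normal_vec d q; pose e : R := (2 * (`|n| + 1))^-1.
have n1 : 0 < `|n| + 1 by rewrite ltr_wpDl.
have e0 : 0 < e by rewrite invr_gt0 mulr_gt0.
have cZ := scaler_cvg0.
have rayE c : ((0, (side s * c) *: n) : stime R) = c *: ((0, side s *: n) : stime R).
  by apply: injective_projections; rewrite /= ?scaler0 // scalerA mulrC.
have rayO : \forall c \near 0^'+, Omega (q.2 + (side s * c) *: n).
  have hO : nbhs (q.2 : 'rV[R]_3) Omega.
    apply: open_nbhs_nbhs; split=> //.
    by case: hGam => /(_ q.1 qT) [-> _ _ _ _] _ _ _; left; right.
  have cO : (q.2 : 'rV[R]_3) + c *: (side s *: n) @[c --> 0^'+] --> (q.2 : 'rV[R]_3).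
    by rewrite -[X in _ --> X]addr0; apply: cvgD; [exact: cvg_cst|exact: cZ].
  have cO' : (q.2 : 'rV[R]_3) + (side s * c) *: n @[c --> 0^'+] --> (q.2 : 'rV[R]_3).
    by under eq_cvg do rewrite mulrC -scalerA.
  exact: (cO' _ hO).
have bnd := cZ _ (stime R) (0, side s *: n) _ (differentiable_bound dd e0).
near=> c.
have c0 : 0 < c by near: c; exact: nbhs_right_gt.
have h : `|d (q + (0, (side s * c) *: n)) - d q - 'd d q (0, (side s * c) *: n)|
    <= e * `|(0, (side s * c) *: n) : stime R|.
  by rewrite rayE; near: c; exact: bnd.
move: h; rewrite (sdist_Gam Om Gq2) subr0 (diff_stime _ dd).
have -> : \sum_(i < 3) ((side s * c) *: n) 0 i * d_x i d q = side s * c.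
  under eq_bigr do rewrite !mxE -mulrA.
  by rewrite -mulr_sumr (sum_normal_sqr hGam Gq) mulr1.
have -> : `|(0, (side s * c) *: n) : stime R| = c * `|n|.
  rewrite prod_normE /= normr0 max_r // normrZ normrM (gtr0_norm c0).
  by congr (_ * _); rewrite /side; case: (s); rewrite ?normrN normr1 mul1r.
have -> : q + (0, (side s * c) *: n) = (q.1, q.2 + (side s * c) *: n).
  by apply: injective_projections; rewrite /= ?addr0.
have : e * (c * `|n|) <= c / 2.
  rewrite mulrCA ler_wpM2l ?(ltW c0) // /e invfM -mulrA ler_piMr ?invr_ge0 //.
  by rewrite mulrC ler_pdivrMr // mul1r lerDl.
move=> /[swap] /le_trans /[apply]; rewrite ler_norml => /andP[h1 h2].
have OmO : Omega (q.2 + (side s * c) *: n) by near: c.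
rewrite -/n; set x := q.2 + _ in h1 h2 OmO *.
have dpos : s -> 0 < d (q.1, x).
  by move=> st; move: h1; rewrite /side st mul1r; lra.
have dneg : ~~ s -> d (q.1, x) < 0.
  by move=> /negPf sf; move: h2; rewrite /side sf mulN1r; lra.
case: (boolP s) => [/dpos|/dneg]; first exact: (@sdist_gt0 _ _ _ _ _ hGam (q.1, x)).
exact: (@sdist_lt0 _ _ _ _ _ hGam (q.1, x)).
Unshelve. all: by end_near. Qed.

End InterfaceNeighbourhood.

(** * Traces and bulk phases *)

Section SmoothExtensions.
Context (R : realType) (V : normedModType R).
Implicit Types (A N : set V) (f h : V -> R).

Lemma smooth_on_deriv N h v : smooth_on N h -> smooth_on N (Defs.deriv v h).
Proof. by move=> sh vs q Nq; have := sh (rcons vs v) q Nq; rewrite foldr_rcons. Qed.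

Lemma smooth_near_deriv A h v : smooth_near A h -> smooth_near A (Defs.deriv v h).
Proof. by move=> [N [oN AN sN]]; exists N; split=> //; exact: smooth_on_deriv. Qed.

Lemma smooth_near_differentiable A h q : smooth_near A h -> A q -> differentiable h q.
Proof. by move=> [N [oN AN sN]] Aq; exact: (sN [::] q (AN _ Aq)). Qed.

Lemma deriv_eq_on A f g v q : open A -> (forall q, A q -> f q = g q) -> A q ->
  Defs.deriv v f q = Defs.deriv v g q.
Proof.
move=> oA fg Aq; have [->|v0] := eqVneq v 0; first by rewrite /Defs.deriv !derive0.
apply: near_eq_derive => //.
by apply: (@filterS _ _ _ A) => //; apply: open_nbhs_nbhs.
Qed.

End SmoothExtensions.

Section Traces.
Context (R : realType) (T : R) (Omega : set (vec R)).
Variables (Om : bool -> R -> set (vec R)) (Gam : R -> set (vec R)).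
Hypothesis hGam : evolving_interface T Omega Om Gam.
Implicit Types (q : stime R).

Lemma trace_proper q s : sweep T Gam q ->
  ProperFilter (within (Om s q.1) (nbhs (q.2 : 'rV[R]_3))).
Proof.
move=> [qT Gq]; apply: within_nbhs_proper.
by case: hGam => /(_ q.1 qT) [_ _ _ _ h] _ _ _; exact: h Gq.
Qed.

(** [trace] is a [lim], informative only when the limit exists. A continuous extension provides the
    limit, and it is unique because interface points adhere to each phase, which makes the filter
    proper. *)
Lemma trace_eq (s : bool) (f h : stime R -> R) q : sweep T Gam q ->
  (forall q, sweep T (Om s) q -> f q = h q) -> {for q, continuous h} ->
  trace Om s f q = h q.
Proof.
move=> Gq fh ch; have PF := trace_proper s Gq; have [qT _] := Gq.
have {}ch : h (q.1, x) @[x --> (q.2 : 'rV[R]_3)] --> h q.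
  move=> P hP; have hq : nbhs ((q.1, q.2) : stime R) (fun q => P (h q)).
    by rewrite -surjective_pairing; exact: ch _ hP.
  exact: (@nbhs_slice R _ q.1 q.2 hq).
rewrite /trace; apply: (@cvg_lim R) => //.
apply: (@cvg_trans _ (h (q.1, x) @[x --> within (Om s q.1) (nbhs (q.2 : 'rV[R]_3))])).
  apply: near_eq_cvg; rewrite near_withinE; near=> x => Ox.
  by rewrite fh.
exact: cvg_within_filter ch.
Unshelve. all: by end_near. Qed.

Lemma trace_const (s : bool) (f : stime R -> R) (c : R) q : sweep T Gam q ->
  (forall q, sweep T (Om s) q -> f q = c) -> trace Om s f q = c.
Proof.
move=> Gq fc; apply: (@trace_eq s f (fun=> c)) => //.
exact: cst_continuous.
Qed.

End Traces.

(** * The leading order phase in the bulk *)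

Section OuterPhase.
Context (R : realType) (T : R) (Omega : set (vec R)).
Variables (Om : bool -> R -> set (vec R)) (Gam : R -> set (vec R)).
Hypothesis hGam : evolving_interface T Omega Om Gam.
Hypothesis hOmega : bounded_domain Omega.
Variables (s : bool) (phi h : stime R -> R).
Hypothesis phi_h : forall q, sweep T (Om s) q -> phi q = h q.
Hypothesis h_smooth : smooth_near (sweep T (fun t => Om s t `|` Gam t)) h.
Hypothesis phi_sign : forall q, sweep T (Om s) q -> 0 < side R s * phi q.
Hypothesis phi_grad : forall i q, sweep T (Om s) q -> (phi q ^+ 3 - phi q) * d_x i phi q = 0.

Let open_sweep : open (sweep T (Om s)). Proof. by case: hGam. Qed.

(** The derivative of the well along the segment is 4 (h^2 - 1) h h', zero inside the phase by
    [phi_grad]. The end points may lie on the interface: this is why the smooth extension [h]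
    replaces [phi]. *)
Lemma outer_well_segment (t : R) (x y : 'rV[R]_3) : 0 < t < T ->
  (Om s t `|` Gam t) x -> (Om s t `|` Gam t) y ->
  (forall c : R, 0 < c < 1 -> Om s t (x + c *: (y - x))) ->
  (h (t, x) ^+ 2 - 1) ^+ 2 = (h (t, y) ^+ 2 - 1) ^+ 2.
Proof.
move=> tT xO yO O; pose p : stime R := (t, x); pose v : stime R := (0, y - x).
have pv c : p + c *: v = (t, x + c *: (y - x)).
  by apply: injective_projections; rewrite /= ?scaler0 ?addr0.
have Ac (c : R) : 0 <= c <= 1 -> sweep T (fun t => Om s t `|` Gam t) (p + c *: v).
  rewrite pv => /andP[]; rewrite le_eqVlt => /predU1P[<- _|c0].
    by split=> //=; rewrite scale0r addr0.
  rewrite le_eqVlt => /predU1P[->|c1]; first by split=> //=; rewrite scale1r addrC subrK.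
  by split=> //=; left; apply: O; rewrite c0.
pose g (c : R) := h (p + c *: v).
have dg (c : R) : 0 <= c <= 1 -> is_derive c (1 : R) g ('D_v h (p + c *: v)).
  move=> /Ac /(smooth_near_differentiable h_smooth) dh.
  by apply: is_derive_line; exact: diff_derivable.
have Dg0 (c : R) : 0 < c < 1 -> (g c ^+ 2 - 1) * g c * 'D_v h (p + c *: v) = 0.
  move=> c01; have Oc : sweep T (Om s) (p + c *: v) by rewrite pv; split=> //=; exact: O.
  have dh : differentiable h (p + c *: v).
    apply: (smooth_near_differentiable h_smooth); apply: Ac.
    by case/andP: c01 => /ltW -> /ltW ->.
  rewrite deriveE // (diff_stime _ dh) mulr_sumr big1 // => i _.
  rewrite /g -phi_h // mulrCA.
  rewrite /d_x -(@deriv_eq_on _ _ _ phi h _ _ open_sweep phi_h Oc).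
  have := phi_grad i Oc; rewrite /d_x => e.
  rewrite (_ : (_ - 1) * _ * _ = (phi (p + c *: v) ^+ 3 - phi (p + c *: v)) *
     Defs.deriv (0, ev R i) phi (p + c *: v)); last by ring.
  by rewrite e mulr0.
pose G (c : R) := (g c ^+ 2 - 1) ^+ 2.
pose dG (c : R) := 2 * (g c ^+ 2 - 1) * (2 * g c * 'D_v h (p + c *: v)).
have hG (c : R) : 0 <= c <= 1 -> is_derive c (1 : R) G (dG c).
  move=> /dg dgc.
  have h1 := is_deriveX 2 dgc; rewrite exprfctE in h1.
  have h2 := is_deriveB h1 (is_derive_cst (1 : R) c (1 : R)).
  have h3 := is_deriveX 2 h2; rewrite exprfctE in h3.
  by move: h3; rewrite subr0 /= !expr1.
have [||c cI e] := @MVT R G dG 0 1 ltr01.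
- move=> c; rewrite in_itv /= => /andP[c0 c1]; apply: hG.
  by rewrite (ltW c0) (ltW c1).
- apply: continuous_in_subspaceT => c; rewrite inE /= in_itv /= => /hG hc.
  by apply: differentiable_continuous; apply/derivable1_diffP; case: hc.
have : G 1 - G 0 = 0.
  rewrite e subr0 mulr1 /dG.
  have := Dg0 c; rewrite in_itv /= in cI => /(_ cI) e0.
  by rewrite (_ : _ * (_ * _) = 4 * ((g c ^+ 2 - 1) * g c * 'D_v h (p + c *: v)));
    [rewrite e0 mulr0|ring].
move/eqP; rewrite subr_eq0 => /eqP.
by rewrite /G /g !pv scale0r addr0 scale1r [x + (y - x)]addrC subrK => ->.
Qed.

(* If h vanished at q, then (h^2 - 1)^2 would equal 1 on a normal ray starting at
   q, where h <> 0; so h^2 = 2 there, contradicting the continuity of h. *)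
Lemma outer_trace_sign q : sweep T Gam q -> 0 < side R s * h q.
Proof.
move=> Gq; have [qT Gq2] := Gq; have oO : open Omega by case: hOmega.
pose n := normal_vec (sdist Om Gam) q; pose x (c : R) := q.2 + (side R s * c) *: n.
have AG : sweep T (fun t => Om s t `|` Gam t) q by split=> //; right.
have cx : h (q.1, x c) @[c --> 0^'+] --> h q.
  have ch : {for q, continuous h}.
    exact: differentiable_continuous (smooth_near_differentiable h_smooth AG).
  have cq : q + c *: ((0, side R s *: n) : stime R) @[c --> 0^'+] --> q.
    by rewrite -[X in _ --> X]addr0; apply: cvgD; [exact: cvg_cst|exact: scaler_cvg0].
  have -> : (fun c => h (q.1, x c)) = (fun c => h (q + c *: ((0, side R s *: n) : stime R))).
    apply/funext => c; congr h; apply: injective_projections; rewrite /= ?scaler0 ?addr0 //.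
    by rewrite scalerA mulrC.
  exact: (cvg_comp _ _ cq ch).
have rayO : \forall c \near 0^'+, Om s q.1 (x c) := normal_ray hGam s oO Gq.
have pos : \forall c \near 0^'+, 0 < side R s * h (q.1, x c).
  by apply: filterS rayO => c Oc; rewrite -phi_h; [exact: phi_sign|]; split.
have ge0 : 0 <= side R s * h q.
  have cs : side R s * h (q.1, x c) @[c --> 0^'+] --> side R s * h q.
    by apply: cvgM => //; exact: cvg_cst.
  by apply: (cvgr_to_ge cs); apply: filterS pos => c /ltW.
rewrite lt_def ge0 andbT; apply/negP => /eqP s0.
have h0 : h q = 0.
  move/eqP: s0; rewrite mulf_eq0 => /orP[|/eqP//]; rewrite /side.
  by case: (s); rewrite ?oppr_eq0 oner_eq0.
have two : \forall c \near 0^'+, h (q.1, x c) ^+ 2 = 2.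
  have /nbhs_ballP[e /= e0 he] := rayO.
  have rayO' c : 0 < c < e -> Om s q.1 (x c).
    by move=> /andP[c0 ce]; apply: he => //; rewrite /ball /= sub0r normrN gtr0_norm.
  near=> c.
  have c0 : 0 < c by near: c; exact: nbhs_right_gt.
  have ce : c < e by near: c; exact: nbhs_right_lt.
  have Oc : Om s q.1 (x c) by apply: rayO'; rewrite c0.
  have := @outer_well_segment q.1 q.2 (x c) qT (or_intror Gq2) (or_introl Oc).
  rewrite -surjective_pairing h0 expr0n sub0r sqrrN expr1n => E1.
  have {}E1 : 1 = (h (q.1, x c) ^+ 2 - 1) ^+ 2.
    apply: E1 => c' /andP[c'0 c'1].
    have -> : (q.2 : 'rV[R]_3) + c' *: (x c - q.2) = x (c' * c).
      by rewrite /x addrAC subrr add0r scalerA; congr (_ + _ *: _); rewrite mulrCA.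
    by apply: rayO'; rewrite mulr_gt0 //= (lt_trans _ ce) // gtr_pMl.
  have hc0 : h (q.1, x c) != 0.
    have : 0 < side R s * h (q.1, x c) by near: c; exact: pos.
    by apply: contraTneq => ->; rewrite mulr0 ltxx.
  apply: (mulfI (expf_neq0 2 hc0)); apply: (@addrI _ 1).
  by rewrite {2}E1; ring.
have c2 : h (q.1, x c) ^+ 2 @[c --> 0^'+] --> 0.
  rewrite -[X in _ --> X](mulr0 0) -[in X in _ --> X]h0.
  by under eq_cvg do rewrite expr2; apply: cvgM.
have lt1 : \forall c \near 0^'+, h (q.1, x c) ^+ 2 < 1 by apply: (cvgr_lt _ c2).
have [c [e1]] : exists c, h (q.1, x c) ^+ 2 = 2 /\ h (q.1, x c) ^+ 2 < 1.
  apply: (@filter_ex _ (0^'+ : set_system R)); near=> c; split; near: c => //.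
by rewrite e1 ltNge ler1n.
Unshelve. all: by end_near. Qed.

Hypothesis h_Gam : forall q, sweep T Gam q -> h q = side R s.

Let well_zero (v : R) : 0 < side R s * v -> (v ^+ 2 - 1) ^+ 2 = 0 -> v = side R s.
Proof.
move=> v0 /eqP; rewrite sqrf_eq0 subr_eq0 sqrf_eq1 => /orP[]/eqP e; rewrite e in v0 *.
  by move: v0; rewrite /side; case: (s) => //; lra.
by move: v0; rewrite /side; case: (s) => //; lra.
Qed.

Let line_open b t (x w : 'rV[R]_3) (c : R) : 0 < t < T -> Om b t (x + c *: w) ->
  exists2 e : R, 0 < e & forall c', `|c - c'| < e -> Om b t (x + c' *: w).
Proof.
move=> tT Oc; have oO : open (Om b t : set 'rV[R]_3) := Om_open hGam (s := b) tT.
have cl : (x + c' *: w) @[c' --> c] --> x + c *: w.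
  by apply: cvgD; [exact: cvg_cst|apply: cvgZl; exact: cvg_id].
have /cl /nbhs_ballP[e /= e0 he] : nbhs (x + c *: w) (Om b t) by apply: open_nbhs_nbhs.
by exists e => // c' /he.
Qed.

(* A segment along which the well (h^2 - 1)^2 is nonzero cannot reach the
   interface, where h = 1 or h = -1; it stays in its phase as long as it stays in
   Omega. *)
Let phase_step t (x y : 'rV[R]_3) : 0 < t < T -> Om s t y -> phi (t, y) <> side R s ->
  (forall c : R, 0 <= c <= 1 -> Omega (y + c *: (x - y))) ->
  Om s t x /\ phi (t, x) <> side R s.
Proof.
move=> tT Oy py yx; pose g (c : R) := y + c *: (x - y).
have g0 : g 0 = y by rewrite /g scale0r addr0.
have g1 : g 1 = x by rewrite /g scale1r addrC subrK.
have Ey : (h (t, y) ^+ 2 - 1) ^+ 2 <> 0.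
  have Sy : sweep T (Om s) (t, y) by [].
  by rewrite -phi_h // => /well_zero h1; apply: py; apply: h1; exact: phi_sign.
have [Z0|] := pselect (forall c : R, 0 <= c <= 1 -> Om s t (g c)).
  have Ox : Om s t x by rewrite -g1; apply: Z0; rewrite ler01 lexx.
  split=> // px; apply: Ey.
  rewrite (outer_well_segment tT (or_introl Oy) (or_introl Ox)); last first.
    by move=> c /andP[c0 c1]; apply: Z0; rewrite !ltW.
  have Sx : sweep T (Om s) (t, x) by [].
  by rewrite -phi_h // px /side; case: (s); ring.
move=> /existsNP[z0 /not_implyP[z01 nz0]]; exfalso; apply: Ey.
(* [c0] is the first exit from the phase. Both phases being open, [g c0] lies neither in this phase
   nor in the other one, hence on the interface, where the well vanishes. *)
pose Z := [set c : R | 0 <= c <= 1 /\ ~ Om s t (g c)].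
have Zi : has_inf Z by split; [exists z0 | exists 0 => c [/andP[]]].
pose c0 := inf Z.
have c00 : 0 <= c0 by apply: lb_le_inf; [exists z0|move=> c [/andP[]]].
have c0z : c0 <= z0 by exact: (ge_inf Zi.2 (conj z01 nz0)).
have before c : 0 <= c < c0 -> Om s t (g c).
  move=> /andP[cp cc0]; apply: contrapT => nO.
  have : c0 <= c; last by rewrite leNgt cc0.
  apply: ge_inf; first exact: Zi.2.
  split=> //; rewrite cp /= (le_trans (ltW cc0)) // (le_trans c0z) //.
  by case/andP: z01.
have nOc0 : ~ Om s t (g c0).
  move=> /(line_open tT)[e e0 he].
  have [c [c01 nO] cc0] := inf_adherent e0 Zi.
  apply: (nO); apply: he; rewrite distrC ger0_norm; first by rewrite ltrBlDl.
  by rewrite subr_ge0; exact: (ge_inf Zi.2 (conj c01 nO)).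
have c0pos : 0 < c0.
  rewrite lt_def c00 andbT; apply/eqP => e; apply: nOc0.
  by rewrite e g0.
have c01 : 0 <= c0 <= 1 by rewrite c00 (le_trans c0z) //; case/andP: z01.
have dec : Omega = Om true t `|` Gam t `|` Om false t.
  by case: hGam => /(_ t tT)[].
have dis : forall b, Om b t `&` Om (~~ b) t = set0.
  case: hGam => /(_ t tT)[_ [h1 _ _] _ _ _] _ _ _ [] //=.
  by rewrite setIC.
have Gc0 : Gam t (g c0).
  have cases : Om s t (g c0) \/ Gam t (g c0) \/ Om (~~ s) t (g c0).
    have := yx c0 c01; rewrite dec -/(g c0).
    by case: (s) => -[[]|]; tauto.
  case: cases => [//|[//|/(line_open tT)[e e0 he]]]; exfalso.
  pose c := Num.max 0 (c0 - e / 2).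
  have cO : Om s t (g c).
    by apply: before; rewrite /c le_max lexx /= gt_max c0pos ltrBlDr ltrDl divr_gt0.
  have cN : Om (~~ s) t (g c).
    apply: he; rewrite ger0_norm; last by rewrite subr_ge0 ge_max c00 gerBl divr_ge0 // ltW.
    rewrite ltrBlDr -ltrBlDl /c lt_max; apply/orP; right.
    by rewrite ltrD2l ltrN2 ltr_pdivrMr // ltr_pMr // ltr1n.
  have : (Om s t `&` Om (~~ s) t) (g c) by [].
  by rewrite dis.
rewrite (outer_well_segment tT (or_introl Oy) (or_intror Gc0)); last first.
  move=> c /andP[cp c1].
  have -> : y + c *: (g c0 - y) = g (c * c0).
    by rewrite /g addrAC subrr add0r scalerA.
  by apply: before; rewrite mulr_ge0 ?(ltW cp) //= gtr_pMl.
rewrite (h_Gam (q := (t, g c0))); last by split.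
by rewrite /side; case: (s); ring.
Qed.

(** By [phase_step] on balls contained in [Omega], the set of bad points of the phase is open and
    closed in [Omega]. If nonempty it would be all of [Omega], which contains interface points. No
    connectedness of the phases themselves enters. *)
Lemma outer_phase_const q : sweep T (Om s) q -> phi q = side R s.
Proof.
move=> [qT Oq]; apply: contrapT => nq; case: q qT Oq nq => t x0 /= tT Ox0 px0.
pose S : set 'rV[R]_3 := [set x | Om s t x /\ phi (t, x) <> side R s].
have [oO cO _ _] := hOmega.
have dec : Omega = Om true t `|` Gam t `|` Om false t.
  by case: hGam => /(_ t tT)[].
have SO : S `<=` Omega.
  by move=> x [Ox _]; rewrite dec; move: Ox; case: (s) => Ox; [left; left|right].
have conv (x y : 'rV[R]_3) (e : R) (c : R) : ball x e y -> 0 <= c <= 1 ->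
    ball x e (y + c *: (x - y)) /\ ball y e (y + c *: (x - y)).
  rewrite -ball_normE /= => xy /andP[c0 c1]; split.
    have -> : x - (y + c *: (x - y)) = (1 - c) *: (x - y).
      by rewrite opprD addrA scalerBl scale1r.
    rewrite normrZ ger0_norm ?subr_ge0 // (le_lt_trans _ xy) // ler_piMl //.
    by rewrite gerBl.
  rewrite opprD addrA subrr sub0r normrN normrZ ger0_norm //.
  by rewrite (le_lt_trans _ xy) // ler_piMl.
have Oball (x : 'rV[R]_3) : Omega x -> exists2 e : R, 0 < e & ball x e `<=` Omega.
  by move=> Ox; apply/nbhs_ballP; apply: open_nbhs_nbhs.
have Sball (x : 'rV[R]_3) (e : R) : ball x e `<=` Omega -> forall y, ball x e y -> S x -> S y.
  move=> xO y xy [Ox px]; apply: (phase_step tT Ox px) => c c01.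
  have [_] := conv y x e c (ball_sym xy) c01; exact: xO.
have Sball' (x : 'rV[R]_3) (e : R) : ball x e `<=` Omega -> forall y, ball x e y -> S y -> S x.
  move=> xO y xy [Oy py]; apply: (phase_step tT Oy py) => c c01.
  have [+ _] := conv x y e c xy c01; exact: xO.
have /cO SE : S !=set0 by exists x0.
have {}SE : S = Omega.
  apply: SE.
    exists S; last by rewrite setIidr.
    rewrite openE => x Sx; have [e e0 he] := Oball x (SO _ Sx).
    by apply/nbhs_ballP; exists e => // y xy; exact: Sball he _ xy Sx.
  exists (closure S); first exact: closed_closure.
  apply/seteqP; split => [x Sx|x [Ox cSx]]; first by split; [exact: SO|exact: subset_closure].
  have [e e0 he] := Oball x Ox.
  have [y [Sy xy]] := cSx _ (nbhsx_ballx x e e0).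
  exact: Sball' he _ xy Sy.
have [y Gy] := Gam_neq0 hGam tT.
have : S y by rewrite SE dec; left; right.
case=> Oy _; case: hGam => /(_ t tT)[_ [_ h1 h2] _ _ _] _ _ _.
have OG : (Om s t `&` Gam t) y by [].
by move: OG; case: (s); rewrite ?h1 ?h2.
Qed.

End OuterPhase.

(** * Inner expansion across the interface *)

Section Slices.
Context (R : realType).

(** A derivative in z sees only the line over [q]: an identity known at a single interface point can
    be differentiated in z. *)
Lemma d_z_slice (F : istime R -> R) (q : stime R) (G G' : R -> R) z :
  (forall z, F (q, z) = G z) -> has_deriv G G' -> d_z F (q, z) = G' z.
Proof.
move=> FG hG; have [_ <-] := hG z.
have e : (fun h : R => h^-1 *: ((F \o shift ((q, z) : istime R))
      (h *: ((0, 0, 1) : istime R)) - F (q, z)))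
    = (fun h : R => h^-1 *: ((G \o shift z) (h *: (1 : R)) - G z)).
  apply/funext => h; rewrite /= /shift /= FG.
  have -> : h *: ((0, 0, 1) : istime R) + (q, z) = (q, h *: (1 : R) + z).
    by do 2?apply: injective_projections; rewrite /= ?scaler0 ?add0r.
  by rewrite FG.
by rewrite /d_z /Defs.deriv /derive e.
Qed.

Lemma smooth_has_deriv A (f : istime R -> R) (q : stime R) :
  smooth_near A f -> (forall z, A (q, z)) ->
  has_deriv (fun z => f (q, z)) (fun z => d_z f (q, z)).
Proof.
move=> sf Aq z; pose p : istime R := (q, 0); pose v : istime R := (0, 0, 1).
have pv c : p + c *: v = (q, c).
  do 2?apply: injective_projections; rewrite /= ?scaler0 ?addr0 ?add0r //.
  exact: mulr1.
have := @is_derive_line _ _ f p v z; rewrite pv (_ : (fun c => _) = fun c => f (q, c)).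
  by apply; apply: diff_derivable; exact: smooth_near_differentiable sf (Aq z).
by apply/funext => c; rewrite pv.
Qed.

Lemma cvg_sum_ord m (F : set_system R) {FF : Filter F} (f : 'I_m -> R -> R) (l : 'I_m -> R) :
  (forall i, f i z @[z --> F] --> l i) ->
  \sum_(i < m) f i z @[z --> F] --> \sum_(i < m) l i.
Proof.
elim: m f l => [|m IH] f l h.
  by rewrite big_ord0; under eq_cvg do rewrite big_ord0; exact: cvg_cst.
rewrite big_ord_recl; under eq_cvg do rewrite big_ord_recl.
by apply: cvgD; [exact: h|apply: IH].
Qed.

Lemma end_z_proper s : ProperFilter (end_z s : set_system R).
Proof. by case: s; exact: _. Qed.

#[local] Existing Instance end_z_proper.

Lemma has_deriv0_end (s : bool) (f f' : R -> R) (l : R) :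
  has_deriv f f' -> (forall z, f' z = 0) -> f z @[z --> end_z s] --> l ->
  forall x, f x = l.
Proof. exact: has_deriv0_cvg. Qed.

End Slices.
#[local] Existing Instance end_z_proper.

(** * Vector identities for a unit normal *)

Section VectorSums.
Context (R : comRingType) (n : 'I_3 -> R).
Hypothesis nn : \sum_(i < 3) n i * n i = 1.

Lemma sum_comb (f g : 'I_3 -> R) (a b : R) :
  \sum_(j < 3) n j * (a * f j + b * g j)
  = a * (\sum_(j < 3) n j * f j) + b * (\sum_(j < 3) n j * g j).
Proof.
rewrite !mulr_sumr -big_split; apply: eq_bigr => j _ /=.
by rewrite mulrDr ![_ (n j) (_ _ _)]mulrCA.
Qed.

Lemma sum_normal (a c : R) : \sum_(j < 3) n j * (c * (n j * a)) = c * a.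
Proof.
rewrite -[in RHS](mulr1 c) -nn mulr_sumr mulr_suml.
by apply: eq_bigr => j _ /=; ring.
Qed.

Lemma sum_proj_sub (a b : 'I_3 -> R) (a0 b0 c : R) :
  (a0 - b0) - c * (\sum_(j < 3) n j * (a j - b j))
  = (a0 - c * \sum_(j < 3) n j * a j) - (b0 - c * \sum_(j < 3) n j * b j).
Proof.
under eq_bigr do rewrite mulrBr.
by rewrite sumrB; move: (\sum_(_ < _) _) (\sum_(_ < _) _) => x y; ring.
Qed.

Lemma sum_sym_normal (b : 'I_3 -> R) (a c : R) : \sum_(j < 3) n j * b j = 0 ->
  \sum_(j < 3) n j * (n j * a + c * b j) = a.
Proof.
move=> nb; have := sum_comb n b a c; rewrite nn nb mulr1 mulr0 addr0 => e; rewrite -[RHS]e.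
by apply: eq_bigr => j _; congr (_ * (_ + _)); rewrite mulrC.
Qed.

Lemma sum_ordS (f : 'I_3 -> R) (i : 'I_3) :
  \sum_(j < 3) f j = f i + f (ordS i) + f (ordS (ordS i)).
Proof.
have e0 : ordS (ord0 : 'I_3) = lift ord0 ord0 by apply/val_inj.
have e1 : ordS (lift ord0 ord0 : 'I_3) = lift ord0 (lift ord0 ord0) by apply/val_inj.
have e2 : ordS (lift ord0 (lift ord0 ord0) : 'I_3) = ord0 by apply/val_inj.
rewrite !big_ord_recl big_ord0 addr0 addrA.
case: (unliftP ord0 i) => [j ->|->]; last by rewrite e0 e1.
case: (unliftP ord0 j) => [l ->|->]; last by rewrite e1 e2 -addrA addrC.
by rewrite (ord1 l) e2 e0 addrC addrA.
Qed.

Lemma ordS3 (i : 'I_3) : ordS (ordS (ordS i)) = i.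
Proof. by apply/val_inj; case: i => [[|[|[]]]]. Qed.

(** This is |n|^2 b = (n.b) n - n x (n x b), written in components. *)
Lemma orthogonal_parallel_eq0 (b : 'I_3 -> R) : \sum_(j < 3) n j * b j = 0 ->
  (forall i, n (ordS i) * b (ordS (ordS i)) - n (ordS (ordS i)) * b (ordS i) = 0) ->
  forall i, b i = 0.
Proof.
move=> nb par i; have := nn; rewrite (sum_ordS _ i) => n1.
have := nb; rewrite (sum_ordS _ i) => {}nb.
have := par i; have := par (ordS i); have := par (ordS (ordS i)); rewrite !ordS3.
move: n1 nb; set a := n i; set c := n (ordS i); set e := n (ordS (ordS i)).
set x := b i; set y := b (ordS i); set z := b (ordS (ordS i)) => n1 nb p2 p1 p0.
have -> : x = (a * a + c * c + e * e) * x by rewrite n1 mul1r.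
have -> : (a * a + c * c + e * e) * x
  = a * (a * x + c * y + e * z) - c * (a * y - c * x) + e * (e * x - a * z) by ring.
by rewrite nb p1 p2; ring.
Qed.

End VectorSums.

(** * Consequences of matching at the interface *)

Section InnerAnalysis.
Context (R : realType) (k : constants R) (hk : constants_pos k) (T : R).
Variables (Omega : set (vec R)) (Om : bool -> R -> set (vec R)) (Gam : R -> set (vec R)).
Hypothesis hOmega : bounded_domain Omega.
Hypothesis hGam : evolving_interface T Omega Om Gam.
Variable (X : outer_coefs R).
Hypothesis X_smooth : forall s c j,
  smooth_upto (sweep T (Om s)) (sweep T (fun t => Om s t `|` Gam t)) (X s c j).
Hypothesis X_sign : forall s q, sweep T (Om s) q -> 0 < side R s * X s Phi 0%N q.
Hypothesis X_sys : forall s, @diffuse_system R (outer (sweep T (Om s))) k (series_of (X s)).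
Variables (r : remainders R) (Y : inner_coefs R).
Hypothesis Y_smooth : forall c j, smooth_near (sweep_inner T Gam) (Y c j).
Local Notation d := (sdist Om Gam).
Hypothesis Y_sys : @diffuse_system R (inner d (sweep_inner T Gam) r) k (series_of Y).
Hypothesis match0 : forall s c q, sweep T Gam q ->
  Y c 0%N (q, z) @[z --> end_z s] --> trace Om s (X s c 0%N) q.
Hypothesis match0' : forall s c q, sweep T Gam q ->
  d_z (Y c 0%N) (q, z) @[z --> end_z s] --> (0 : R).
Hypothesis match1 : forall s c q, sweep T Gam q ->
  d_z (Y c 1%N) (q, z) @[z --> end_z s] -->
    \sum_(i < 3) trace Om s (d_x i (X s c 0%N)) q * normal d i q.

Lemma hat_lambda_gt0 : 0 < hat_lambda k.
Proof. by case: hk => _ _ _ [_ l0 _ _]; rewrite mulr_gt0 // divr_gt0 // mulr_gt0 // sqrtr_gt0. Qed.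

Lemma outer_well_critical s i q : sweep T (Om s) q ->
  (X s Phi 0%N q ^+ 3 - X s Phi 0%N q) * d_x i (X s Phi 0%N) q = 0.
Proof.
move=> Oq; have [e _] := outer_momentum (@X_sys s) i Oq.
move: e; rewrite (outer_potential (@X_sys s) Oq) -mulrA => /eqP.
by rewrite mulf_eq0 gt_eqF ?hat_lambda_gt0 // => /eqP.
Qed.

(** One smooth extension serves for a field and for its first derivatives, since these agree on the
    open phase. *)
Lemma smooth_traces (s : bool) c : exists h : stime R -> R,
  [/\ smooth_near (sweep T (fun t => Om s t `|` Gam t)) h,
      forall q, sweep T (Om s) q -> X s c 0%N q = h q,
      forall q, sweep T Gam q -> differentiable h q,
      forall q, sweep T Gam q -> trace Om s (X s c 0%N) q = h q &
      forall q i, sweep T Gam q -> trace Om s (d_x i (X s c 0%N)) q = d_x i h q].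
Proof.
have [h sh Xh] := X_smooth s c 0%N.
have AG q : sweep T Gam q -> sweep T (fun t => Om s t `|` Gam t) q.
  by move=> [qT Gq]; split=> //; right.
exists h; split=> // [q Gq|q Gq|q i Gq].
- exact: smooth_near_differentiable sh (AG _ Gq).
- apply: (trace_eq hGam Gq Xh); apply: differentiable_continuous.
  exact: smooth_near_differentiable sh (AG _ Gq).
- apply: (trace_eq hGam Gq (h := d_x i h)).
    by move=> q' Oq'; apply: deriv_eq_on Oq' => //; case: hGam.
  apply: differentiable_continuous.
  exact: smooth_near_differentiable (smooth_near_deriv _ sh) (AG _ Gq).
Qed.

Lemma trace_phase_sign s q : sweep T Gam q -> 0 < side R s * trace Om s (X s Phi 0%N) q.
Proof.
move=> Gq; have [h [sh Xh _ th _]] := smooth_traces s Phi; rewrite th //.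
apply: (outer_trace_sign hGam hOmega Xh sh) => // [q'|i q' Oq'].
  exact: X_sign.
exact: outer_well_critical.
Qed.

Lemma trace_potential s q : sweep T Gam q -> trace Om s (X s Mu 0%N) q =
  hat_lambda k * (trace Om s (X s Phi 0%N) q ^+ 3 - trace Om s (X s Phi 0%N) q).
Proof.
move=> Gq; have [h [sh Xh dh th _]] := smooth_traces s Phi; rewrite th //.
have cubeE (x : R) : x ^+ 3 = x * x * x by rewrite !exprS expr0 mulr1 mulrA.
rewrite cubeE; apply: (trace_eq hGam Gq
  (h := fun q => hat_lambda k * (h q * h q * h q - h q))).
  by move=> q' Oq'; rewrite (outer_potential (@X_sys s) Oq') Xh // cubeE.
have ch : {for q, continuous h} by apply: differentiable_continuous; exact: dh.
apply: cvgM; first exact: cvg_cst.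
by apply: cvgB => //; do 2?apply: cvgM.
Qed.

Section AtPoint.
Variable q : stime R.
Hypothesis Gq : sweep T Gam q.

Local Notation n i := (normal d i q).
Local Notation V := (normal_velocity d q).
Local Notation y c j := (fun z => Y c j (q, z)).
Local Notation y' c j := (fun z => d_z (Y c j) (q, z)).
Local Notation y'' c j := (fun z => d_z (d_z (Y c j)) (q, z)).

Let in_sweep z : sweep_inner T Gam ((q, z) : istime R). Proof. exact: Gq. Qed.

Let dy c j : has_deriv (y c j) (y' c j).
Proof. exact: smooth_has_deriv (Y_smooth c j) in_sweep. Qed.

Let dy' c j : has_deriv (y' c j) (y'' c j).
Proof. by apply: smooth_has_deriv in_sweep; exact: smooth_near_deriv. Qed.

Let nn : \sum_(i < 3) n i * n i = 1 := sum_normal_sqr hGam Gq.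

Let eta z := (eta_ k true - eta_ k false) / 2 * Y Phi 0%N (q, z)
  + (eta_ k true + eta_ k false) / 2.
Let eta' z := (eta_ k true - eta_ k false) / 2 * d_z (Y Phi 0%N) (q, z).

Let deta : has_deriv eta eta'.
Proof.
apply: has_deriv_ext (has_derivD (has_derivZ _ (dy Phi 0)) (has_deriv_cst _)) _ => z.
by rewrite addr0.
Qed.

Let nu' z : \sum_(i < 3) n i * d_z (Y (Vel i) 0%N) (q, z) = 0.
Proof. by have := inner_div_velocity Y_sys (in_sweep z). Qed.

Let nu'' z : \sum_(i < 3) n i * d_z (d_z (Y (Vel i) 0%N)) (q, z) = 0.
Proof.
have h := has_deriv_sum (fun i => has_derivZ (n i) (dy' (Vel i) 0)).
have := h z; have -> : (fun z => \sum_(i < 3) n i * y' (Vel i) 0%N z) = cst 0.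
  by apply/funext => w; exact: nu'.
by case=> _ <-; rewrite derive_cst.
Qed.

(** The identities n.u0' = 0 and n.u0'' = 0 remove the transposed half of the strain, so that only
    (eta u0')' remains of the viscous term. *)
Let momentumN2 i z : eta' z * d_z (Y (Vel i) 0%N) (q, z)
  + eta z * d_z (d_z (Y (Vel i) 0%N)) (q, z)
  + Y Mu 0%N (q, z) * (n i * d_z (Y Phi 0%N) (q, z)) = 0.
Proof.
have [+ _] := inner_momentum Y_sys i (in_sweep z) => <-; congr (_ + _).
pose g j z := eta z * (n j * d_z (Y (Vel i) 0%N) (q, z) + n i * d_z (Y (Vel j) 0%N) (q, z)).
pose g' j z := eta' z * (n j * d_z (Y (Vel i) 0%N) (q, z) + n i * d_z (Y (Vel j) 0%N) (q, z))
  + eta z * (n j * d_z (d_z (Y (Vel i) 0%N)) (q, z) + n i * d_z (d_z (Y (Vel j) 0%N)) (q, z)).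
have dg j : has_deriv (g j) (g' j).
  exact: has_derivM deta (has_derivD (has_derivZ _ (dy' _ _)) (has_derivZ _ (dy' _ _))).
under [RHS]eq_bigr => j _.
  rewrite (@d_z_slice _ _ q (g j) (g' j)) //; last first.
    by move=> w; rewrite /inner_stressN1 /inner_strainN1 mulrACA divff ?pnatr_eq0 // mul1r.
  over.
rewrite /g' (sum_comb (fun j => n j)) sum_sym_normal ?sum_sym_normal //; exact: nu''.
Qed.

Let mu_phi' z : Y Mu 0%N (q, z) * d_z (Y Phi 0%N) (q, z) = 0.
Proof.
have : \sum_(i < 3) n i * (1 * (eta' z * d_z (Y (Vel i) 0%N) (q, z)
  + eta z * d_z (d_z (Y (Vel i) 0%N)) (q, z))
  + Y Mu 0%N (q, z) * (n i * d_z (Y Phi 0%N) (q, z))) = 0.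
  by rewrite big1 // => i _; rewrite mul1r momentumN2 mulr0.
rewrite sum_comb sum_comb nu' nu'' !mulr0 addr0 mulr0 add0r mulr_sumr.
by under eq_bigr do rewrite mulrCA; rewrite sum_normal.
Qed.

Let cvg_eta s : eta z @[z --> end_z s] -->
  (eta_ k true - eta_ k false) / 2 * trace Om s (X s Phi 0%N) q
  + (eta_ k true + eta_ k false) / 2.
Proof.
apply: cvgD; last exact: cvg_cst.
by apply: cvgM; [exact: cvg_cst|exact: match0].
Qed.

Let eta_u'0 i z : eta z * d_z (Y (Vel i) 0%N) (q, z) = 0.
Proof.
apply: (has_deriv0_end (s := true) (has_derivM deta (dy' (Vel i) 0))).
  move=> w; have := momentumN2 i w; rewrite mulrCA mu_phi' mulr0 addr0; exact.
rewrite -(mulr0 ((eta_ k true - eta_ k false) / 2 * trace Om true (X true Phi 0%N) q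
  + (eta_ k true + eta_ k false) / 2)).
by apply: cvgM; [exact: cvg_eta | exact: match0'].
Qed.

Let un_const z : \sum_(i < 3) n i * Y (Vel i) 0%N (q, z) = \sum_(i < 3) n i * Y (Vel i) 0%N (q, 0).
Proof.
have h := has_deriv_sum (fun i => has_derivZ (n i) (dy (Vel i) 0)).
exact: (has_deriv0_eq z 0 h nu').
Qed.

Let U := \sum_(i < 3) n i * Y (Vel i) 0%N (q, 0).

Let phase z : mob k * d_z (d_z (Y Mu 0%N)) (q, z) - (U - V) * d_z (Y Phi 0%N) (q, z) = 0.
Proof.
have := inner_phase Y_sys (in_sweep z) => /=.
under eq_bigr => i _.
  rewrite (d_z_slice z (fun _ => erefl) (has_derivM (dy Phi 0) (dy (Vel i) 0))).
  over.
under [in RHS]eq_bigr => i _.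
  rewrite (d_z_slice z (fun _ => erefl) (has_derivZ (mob k) (has_derivZ (n i) (dy' Mu 0)))).
  over.
rewrite (sum_comb (fun j => n j)) (sum_normal nn) nu' mulr0 addr0 un_const -/U => <-.
by move: (d_z (Y Phi 0%N) (q, z)) U V => P a b; ring.
Qed.

Let trace_sep : trace Om true (X true Phi 0%N) q != trace Om false (X false Phi 0%N) q.
Proof.
have := trace_phase_sign true Gq; have := trace_phase_sign false Gq; rewrite /side.
by move=> h1 h2; apply/eqP => e; move: h1 h2; rewrite e; lra.
Qed.

(* First integral of the phase equation; comparing its limits at both ends forces
   U = V since the traces of phi differ. *)
Let W z := mob k * d_z (Y Mu 0%N) (q, z) - (U - V) * Y Phi 0%N (q, z).

Let dW : has_deriv W (fun z => mob k * d_z (d_z (Y Mu 0%N)) (q, z)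
   - (U - V) * d_z (Y Phi 0%N) (q, z)).
Proof. exact: has_derivD (has_derivZ _ (dy' Mu 0)) (has_derivN (has_derivZ _ (dy Phi 0))). Qed.

Let cvgW s : W z @[z --> end_z s] --> mob k * 0 - (U - V) * trace Om s (X s Phi 0%N) q.
Proof.
apply: cvgB; apply: cvgM; try exact: cvg_cst; [exact: match0'|exact: match0].
Qed.

Lemma interface_velocity_inner : V = \sum_(i < 3) n i * Y (Vel i) 0%N (q, 0).
Proof.
have h (s : bool) := has_deriv0_end (s := s) dW phase (@cvgW s) 0.
have := h true; rewrite (h false) => /addrI/oppr_inj/eqP.
rewrite -subr_eq0 -mulrBr mulf_eq0 subr_eq0 subr_eq0 => /orP[/eqP UV|]; first exact: esym UV.
by rewrite eq_sym (negPf trace_sep).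
Qed.

(** Once mu0 is constant in z, a nonzero value would turn mu0 phi0' = 0 into phi0' = 0, and phi0
    would have equal limits at both ends, against [trace_sep]. *)
Lemma inner_potential0 z : Y Mu 0%N (q, z) = 0.
Proof.
have mu'0 w : d_z (Y Mu 0%N) (q, w) = 0.
  have := has_deriv0_end (s := true) dW phase (@cvgW true) w.
  rewrite /W /U -interface_velocity_inner subrr !mul0r mulr0 => /eqP.
  rewrite !subr0 mulf_eq0 => /orP[|/eqP//].
  by case: hk => _ _ _ [_ _ _ m0]; rewrite gt_eqF.
have mu_cst w : Y Mu 0%N (q, w) = Y Mu 0%N (q, z) := has_deriv0_eq w z (dy Mu 0) mu'0.
apply: contrapT => /eqP muz; move/eqP: trace_sep; apply.
have phi'0 w : d_z (Y Phi 0%N) (q, w) = 0.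
  by have /eqP := mu_phi' w; rewrite mu_cst mulf_eq0 (negPf muz) => /eqP.
have hs (s : bool) := has_deriv0_end (s := s) (dy Phi 0) phi'0 (@match0 s Phi q Gq) 0.
by rewrite -hs -hs.
Qed.

(** By matching, the trace of mu0 vanishes, so the trace of phi0 is 0, 1 or -1; its strict sign
    leaves one choice. *)
Lemma trace_phase s : trace Om s (X s Phi 0%N) q = side R s.
Proof.
have h := @match0 s Mu q Gq.
have mu_cst (x w : R) : Y Mu 0%N (q, x) = Y Mu 0%N (q, w) by rewrite !inner_potential0.
have := cst_cvg_eq (F := end_z s) (FF := end_z_proper R s) mu_cst h 0.
rewrite inner_potential0 trace_potential // => /esym/eqP.
rewrite mulf_eq0 gt_eqF ?hat_lambda_gt0 //=.
have := trace_phase_sign s Gq; set a := trace _ _ _ _ => a0.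
rewrite (_ : a ^+ 3 - a = a * (a - 1) * (a + 1)); last by ring.
rewrite !mulf_eq0 subr_eq0 addr_eq0 => /orP[/orP[]|] /eqP ae; move: a0; rewrite ae /side;
  by case: (s) => //; lra.
Qed.

Lemma inner_phase'' : has_deriv (y' Phi 0%N) (fun z => Y Phi 0%N (q, z) ^+ 3 - Y Phi 0%N (q, z)).
Proof.
apply: has_deriv_ext (dy' Phi 0) _ => z /=.
have [+ _] := inner_potential Y_sys (in_sweep z); rewrite inner_potential0 => /esym/eqP.
rewrite mulf_eq0 gt_eqF ?hat_lambda_gt0 //= => /eqP; lra.
Qed.

Let cvg_phi_y : Y Phi 0%N (q, z) @[z --> +oo] --> (1 : R).
Proof. by have := @match0 true Phi q Gq; rewrite trace_phase. Qed.
Let cvg_phi_Ny : Y Phi 0%N (q, z) @[z --> -oo] --> (-1 : R).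
Proof. by have := @match0 false Phi q Gq; rewrite trace_phase. Qed.

Lemma inner_phase_lt1 z : 0 < 1 - Y Phi 0%N (q, z) ^+ 2.
Proof.
exact: (profile_lt1 (dy Phi 0) inner_phase'' cvg_phi_y cvg_phi_Ny (@match0' true Phi q Gq)).
Qed.

Lemma inner_phase_profile z :
  d_z (Y Phi 0%N) (q, z) = (1 - Y Phi 0%N (q, z) ^+ 2) / Num.sqrt 2.
Proof.
exact: (profile_derivative (dy Phi 0) inner_phase'' cvg_phi_y cvg_phi_Ny
  (@match0' true Phi q Gq)).
Qed.

Lemma inner_velocity' i z : d_z (Y (Vel i) 0%N) (q, z) = 0.
Proof.
have /eqP := eta_u'0 i z; rewrite mulf_eq0 gt_eqF => [/eqP//|].
(* For phi0 strictly between -1 and 1, [eta] is a convex combination of the two positive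
   viscosities. *)
case: hk => _ e0 _ _; have := e0 true; have := e0 false.
have := inner_phase_lt1 z; rewrite /eta; set f := Y _ _ _ => f1 ef et.
have [f2 f3] : -1 < f /\ f < 1 by split; nra.
by nra.
Qed.

Lemma velocity_trace s i z : Y (Vel i) 0%N (q, z) = trace Om s (X s (Vel i) 0%N) q.
Proof. exact: (has_deriv0_end (dy (Vel i) 0) (inner_velocity' i) (@match0 s (Vel i) q Gq)). Qed.

Let magnetic' i z : d_z (Y (Mag i) 0%N) (q, z) = 0.
Proof.
apply: (orthogonal_parallel_eq0 nn (b := fun i => d_z (Y (Mag i) 0%N) (q, z))).
  by have := inner_div_magnetic Y_sys (in_sweep z).
by move=> j; have := inner_curl_magnetic Y_sys j (in_sweep z).
Qed.

Lemma magnetic_trace s i : Y (Mag i) 0%N (q, 0) = trace Om s (X s (Mag i) 0%N) q.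
Proof. exact: (has_deriv0_end (dy (Mag i) 0) (magnetic' i) (@match0 s (Mag i) q Gq)). Qed.

Lemma electric_trace s i :
  n (ordS i) * Y (Ele (ordS (ordS i))) 0%N (q, 0)
    - n (ordS (ordS i)) * Y (Ele (ordS i)) 0%N (q, 0)
  = n (ordS i) * trace Om s (X s (Ele (ordS (ordS i))) 0%N) q
    - n (ordS (ordS i)) * trace Om s (X s (Ele (ordS i)) 0%N) q.
Proof.
have h := has_derivD (has_derivZ (n (ordS i)) (dy (Ele (ordS (ordS i))) 0))
  (has_derivN (has_derivZ (n (ordS (ordS i))) (dy (Ele (ordS i)) 0))).
apply: (has_deriv0_end (s := s) h) => [z|].
  have := inner_faraday Y_sys i (in_sweep z); rewrite magnetic' mulr0 add0r; exact.
by apply: cvgB; apply: cvgM; try exact: cvg_cst; exact: match0.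
Qed.

Lemma current_trace s : \sum_(i < 3) n i * Y (Cur i) 0%N (q, 0)
  = \sum_(i < 3) n i * trace Om s (X s (Cur i) 0%N) q.
Proof.
have h := has_deriv_sum (fun i => has_derivZ (n i) (dy (Cur i) 0)).
apply: (has_deriv0_end (s := s) h) => [z|].
  by have := inner_div_current Y_sys (in_sweep z).
apply: cvg_sum_ord => i; apply: cvgM; [exact: cvg_cst|exact: match0].
Qed.

End AtPoint.

Lemma outer_phase_eq s q : sweep T (Om s) q -> X s Phi 0%N q = side R s.
Proof.
have [h [sh Xh _ th _]] := smooth_traces s Phi.
apply: (outer_phase_const hGam hOmega Xh sh) => [q'|i q' Oq'|q' Gq'].
- exact: X_sign.
- exact: outer_well_critical.
- by rewrite -th // trace_phase.
Qed.

Lemma outer_phase_d_x s i q : sweep T (Om s) q -> d_x i (X s Phi 0%N) q = 0.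
Proof.
move=> Oq; rewrite /d_x (@deriv_eq_on _ _ _ _ (fun=> side R s) _ _ _ (@outer_phase_eq s) Oq).
  exact: derive_cst.
by case: hGam.
Qed.

Lemma inner_stressN1_eq0 i j p : sweep_inner T Gam p -> inner_stressN1 k d Y i j p = 0.
Proof.
case: p => q z Gq.
rewrite /inner_stressN1 /inner_strainN1 !(inner_velocity' Gq).
have zero (e a b c : R) : e * (c * (a * 0 + b * 0)) = 0 by rewrite !mulr0 addr0 !mulr0.
exact: zero.
Qed.

(** * Stress balance and surface tension *)

Section StressBalance.
Variable q : stime R.
Hypothesis Gq : sweep T Gam q.

Local Notation n i := (normal d i q).
Local Notation y c j := (fun z => Y c j (q, z)).
Local Notation y' c j := (fun z => d_z (Y c j) (q, z)).
Local Notation y'' c j := (fun z => d_z (d_z (Y c j)) (q, z)).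
Local Notation grad s i j := (trace Om s (d_x j (X s (Vel i) 0%N)) q).
Local Notation pres s := (trace Om s (X s Prs 0%N) q).

Let in_sweep z : sweep_inner T Gam ((q, z) : istime R). Proof. exact: Gq. Qed.
Let dy c j : has_deriv (y c j) (y' c j).
Proof. exact: smooth_has_deriv (Y_smooth c j) in_sweep. Qed.
Let dy' c j : has_deriv (y' c j) (y'' c j).
Proof. by apply: smooth_has_deriv in_sweep; exact: smooth_near_deriv. Qed.
Let nn : \sum_(i < 3) n i * n i = 1 := sum_normal_sqr hGam Gq.

(** The inner velocity and the smooth extension of the outer one agree at all interface points and
    for all z, so their difference has no surface gradient. Hence the left side is independent of z,
    and the projected outer gradient is the same from both phases. *)
Lemma surf_grad_velocity s i j z : surf_grad d j (Y (Vel i) 0%N) (q, z)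
  = grad s i j - n j * \sum_(l < 3) n l * grad s i l.
Proof.
have [h [sh Xh dh th dth]] := smooth_traces s (Vel i).
pose H := fun p : istime R => h p.1.
have dY : differentiable (Y (Vel i) 0%N) ((q, z) : istime R).
  exact: smooth_near_differentiable (Y_smooth _ _) (in_sweep z).
have dH : differentiable H ((q, z) : istime R) by apply: differentiable_fst_comp; exact: dh.
have := @surf_grad_eq0 _ _ _ _ _ hGam (Y (Vel i) 0%N - H) (q, z) j (in_sweep z)
  (differentiableB dY dH) => F0.
have di l : di_x l (Y (Vel i) 0%N - H) (q, z) = di_x l (Y (Vel i) 0%N) (q, z) - grad s i l.
  rewrite dth // /di_x /Defs.deriv deriveB //; exact: diff_derivable.
have : surf_grad d j (Y (Vel i) 0%N - H) (q, z) = 0.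
  apply: F0 => -[q' z'] Gq'.
  have -> : (Y (Vel i) 0%N - H) (q', z') = Y (Vel i) 0%N (q', z') - h q' by [].
  by rewrite (velocity_trace Gq' s) th // subrr.
rewrite {1}/surf_grad di; under eq_bigr do rewrite di.
by rewrite sum_proj_sub => /eqP; rewrite subr_eq0 => /eqP.
Qed.

Lemma inner_stressN1_differentiable i j z :
  differentiable (inner_stressN1 k d Y i j) ((q, z) : istime R).
Proof.
have dY c m : differentiable (Y c m) ((q, z) : istime R).
  exact: smooth_near_differentiable (Y_smooth _ _) (in_sweep z).
have dY' c m : differentiable (d_z (Y c m)) ((q, z) : istime R).
  exact: smooth_near_differentiable (smooth_near_deriv _ (Y_smooth _ _)) (in_sweep z).
have dn l : differentiable (fun p : istime R => normal d l p.1) ((q, z) : istime R).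
  by apply: differentiable_fst_comp; exact: (normal_differentiable hGam l Gq).
have dc (c : R) : differentiable (fun=> c) ((q, z) : istime R) by exact: differentiable_cst.
exact: differentiableM
  (differentiableM (dc 2) (differentiableD (differentiableM (dc _) (dY Phi 0)) (dc _)))
  (differentiableM (dc _) (differentiableD (differentiableM (dn j) (dY' (Vel i) 0))
     (differentiableM (dn i) (dY' (Vel j) 0)))).
Qed.

Let eta z := (eta_ k true - eta_ k false) / 2 * Y Phi 0%N (q, z)
  + (eta_ k true + eta_ k false) / 2.
Let proj s i j := grad s i j - n j * \sum_(l < 3) n l * grad s i l.
(** The order 0 stress after u0' = 0, with the surface gradients replaced by constants in z. Reading
    them from the phase [true] is an arbitrary choice. *)
Let stress1 i j z := eta z * (n j * d_z (Y (Vel i) 1%N) (q, z) + proj true i j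
    + (n i * d_z (Y (Vel j) 1%N) (q, z) + proj true j i))
  - (i == j)%:R * Y Prs 0%N (q, z).

Let inner_stress0E i j z : inner_stress0 k d Y i j (q, z) = stress1 i j z.
Proof.
have zero (e e' a b b' c c' : R) : c' != 0 ->
    c' * e * (c'^-1 * a) + c' * e' * (c * (b * 0 + b' * 0)) = e * a.
  by move=> c0; rewrite mulrACA divff // mul1r !mulr0 addr0 !mulr0 addr0.
rewrite /inner_stress0 /inner_strain0 /inner_strainN1 !(inner_velocity' Gq).
rewrite !(surf_grad_velocity true) /stress1; congr (_ - _).
by apply: zero; rewrite pnatr_eq0.
Qed.

Let dstress1 i j : exists S', has_deriv (stress1 i j) S'.
Proof.
have deta := has_derivD (has_derivZ ((eta_ k true - eta_ k false) / 2) (dy Phi 0))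
  (has_deriv_cst ((eta_ k true + eta_ k false) / 2)).
eexists; apply: has_derivD; last exact: has_derivN (has_derivZ _ (dy Prs 0)).
apply: has_derivM deta _; apply: has_derivD; apply: has_derivD;
  try exact: has_deriv_cst; exact: has_derivZ (dy' _ _).
Qed.

(** Inertia drops out by u0' = 0, and mu0 = 0 leaves mu1 phi0' n of the capillary force. The order
    -1 stress vanishes on the whole interface, so its surface gradient is zero. *)
Let momentum i : has_deriv (fun z => \sum_(j < 3) n j * stress1 i j z)
  (fun z => - (Y Mu 1%N (q, z) * (n i * d_z (Y Phi 0%N) (q, z)))).
Proof.
pose S' j := sval (cid (dstress1 i j)).
have dS j : has_deriv (stress1 i j) (S' j) by rewrite /S'; case: cid.
apply: has_deriv_ext (has_deriv_sum (fun j => has_derivZ (n j) (dS j))) _ => z.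
have [_] := inner_momentum Y_sys i (in_sweep z).
have -> : \sum_(j < 3) (n j * d_z (inner_stress0 k d Y i j) (q, z)
    + surf_grad d j (inner_stressN1 k d Y i j) (q, z)) = \sum_(j < 3) n j * S' j z.
  apply: eq_bigr => j _.
  rewrite (d_z_slice z (inner_stress0E i j) (dS j)).
  rewrite (surf_grad_eq0 hGam j (in_sweep z) (inner_stressN1_differentiable i j z)).
    exact: addr0.
  exact: inner_stressN1_eq0.
rewrite (inner_potential0 Gq) (inner_velocity' Gq).
have isolate (rho v : R) (f : 'I_3 -> R) (S a b : R) :
    rho * (v * 0) + \sum_(j < 3) f j * (n j * 0) = S + (0 * a + b) -> S = - b.
  rewrite !mulr0 mul0r !add0r big1 => [/esym/eqP|j _]; last by rewrite !mulr0.
  by rewrite addr_eq0 => /eqP.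
exact: isolate.
Qed.

(* mu1 phi0' = hat_lambda profile_term', because phi0' solves the linearized
   equation phi0''' = (3 phi0^2 - 1) phi0'; recall phi0'' = - phi0 (1 - phi0^2). *)
Let profile_term z := - (Y Phi 0%N (q, z) * (Y Phi 1%N (q, z) * (1 - Y Phi 0%N (q, z) ^+ 2)))
  - d_z (Y Phi 1%N) (q, z) * d_z (Y Phi 0%N) (q, z)
  + curvature d q / Num.sqrt 2 * (Y Phi 0%N (q, z) - 3^-1 * Y Phi 0%N (q, z) ^+ 3).

Let dphi : has_deriv (y Phi 0%N) (fun z => (1 - Y Phi 0%N (q, z) ^+ 2) / Num.sqrt 2).
Proof. by apply: has_deriv_ext (dy Phi 0) _ => z; rewrite (inner_phase_profile Gq). Qed.

Let one_sub_sqr : has_deriv (fun z => 1 - Y Phi 0%N (q, z) ^+ 2)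
  (fun z => - (Num.sqrt 2 * Y Phi 0%N (q, z)) * (1 - Y Phi 0%N (q, z) ^+ 2)).
Proof.
apply: has_deriv_ext (has_derivD (has_deriv_cst 1) (has_derivN (has_derivX 2 dphi))) _ => z.
have : Num.sqrt 2 != 0 :> R by rewrite gt_eqF // sqrtr_gt0.
have : Num.sqrt 2 ^+ 2 = 2 :> R by rewrite sqr_sqrtr.
move: (Y Phi 0%N (q, z)) (Num.sqrt 2) => a b b2 b0 /=.
by rewrite expr1 -b2; field.
Qed.

Let dprofile_term : has_deriv profile_term (fun z => d_z (Y Phi 0%N) (q, z) *
  (- d_z (d_z (Y Phi 1%N)) (q, z) + curvature d q * d_z (Y Phi 0%N) (q, z)
    + (3 * Y Phi 0%N (q, z) ^+ 2 - 1) * Y Phi 1%N (q, z))).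
Proof.
have hd := has_derivD (has_derivD
    (has_derivN (has_derivM dphi (has_derivM (dy Phi 1) one_sub_sqr)))
    (has_derivN (has_derivM (dy' Phi 1) (inner_phase'' Gq))))
  (has_derivZ (curvature d q / Num.sqrt 2)
    (has_derivD dphi (has_derivN (has_derivZ 3^-1 (has_derivX 3 dphi))))).
apply: has_deriv_ext hd _ => z; rewrite (inner_phase_profile Gq) /=.
have : Num.sqrt 2 != 0 :> R by rewrite gt_eqF // sqrtr_gt0.
have : Num.sqrt 2 ^+ 2 = 2 :> R by rewrite sqr_sqrtr.
move: (Y Phi 0%N (q, z)) (Y Phi 1%N (q, z)) (d_z (Y Phi 1%N) (q, z))
  (d_z (d_z (Y Phi 1%N)) (q, z)) (curvature d q) (Num.sqrt 2) => a f f' f'' kap b b2 b0.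
(* With sqrt 2 moved to the denominator in this term, the identity holds for any nonzero [b], and
   [field] need not know b^2 = 2. *)
have -> : b * a = 2 / b * a by rewrite -b2; field.
by field.
Qed.

Let balance i z : \sum_(j < 3) n j * stress1 i j z + n i * (hat_lambda k * profile_term z)
  = \sum_(j < 3) n j * stress1 i j 0 + n i * (hat_lambda k * profile_term 0).
Proof.
apply: (has_deriv0_eq z 0 (has_derivD (momentum i)
  (has_derivZ (n i) (has_derivZ (hat_lambda k) dprofile_term)))) => w.
have [_ ->] := inner_potential Y_sys (in_sweep w).
move: (d_z (Y Phi 0%N) (q, w)) (hat_lambda k) (n i) => a b c.
rewrite /=; move: (- _ + _ + _) => e.
by ring.
Qed.

Lemma trace_phase_d_x s i : trace Om s (d_x i (X s Phi 0%N)) q = 0.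
Proof. by apply: (trace_const hGam Gq) => q'; exact: outer_phase_d_x. Qed.

Let cvg_phi s : Y Phi 0%N (q, z) @[z --> end_z s] --> side R s.
Proof. by rewrite -(trace_phase Gq); exact: match0. Qed.

Let cvg_phi1' s : d_z (Y Phi 1%N) (q, z) @[z --> end_z s] --> (0 : R).
Proof.
have := @match1 s Phi q Gq; rewrite big1 // => i _.
by rewrite trace_phase_d_x mul0r.
Qed.

Let cvg_one_sub_sqr s : 1 - Y Phi 0%N (q, z) ^+ 2 @[z --> end_z s] --> (0 : R).
Proof.
have -> : 0 = 1 - side R s * side R s :> R by rewrite /side; case: (s); ring.
apply: cvgB; first exact: cvg_cst.
by under eq_cvg do rewrite expr2; apply: cvgM.
Qed.

(** [phi1] may be unbounded, but its derivative tends to 0. By [one_sub_sqr], the factor 1 - phi0^2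
    solves f' = - sqrt 2 phi0 f, and phi0 tends to 1 and -1: it decays at the rate sqrt 2 at both
    ends. *)
Let cvg_slow s : Y Phi 1%N (q, z) * (1 - Y Phi 0%N (q, z) ^+ 2) @[z --> end_z s] --> (0 : R).
Proof.
have s2 : 0 < Num.sqrt 2 :> R by rewrite sqrtr_gt0.
have lt1 := inner_phase_lt1 Gq.
have h1 := @cvg_phi1' s; have h2 := @cvg_one_sub_sqr s; have h3 := @cvg_phi s.
case: s h1 h2 h3 => h1 h2 h3.
  apply: (slow_mul_decaying s2 lt1 one_sub_sqr (dy Phi 1) _ h1 h2).
  by rewrite -[X in _ --> X]mulr1; apply: cvgM => //; exact: cvg_cst.
apply: (slow_mul_decayingNy s2 lt1 one_sub_sqr (dy Phi 1) _ h1 h2).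
rewrite -[X in _ --> X]opprK; apply: cvgN.
by rewrite -mulrN1; apply: cvgM => //; exact: cvg_cst.
Qed.

Let cvg_profile_term s : profile_term z @[z --> end_z s] -->
  curvature d q / Num.sqrt 2 * (side R s - 3^-1 * side R s).
Proof.
have -> : curvature d q / Num.sqrt 2 * (side R s - 3^-1 * side R s)
    = - (side R s * 0) - 0 * 0 + curvature d q / Num.sqrt 2 * (side R s - 3^-1 * side R s).
  by rewrite !mulr0 oppr0 !add0r.
apply: cvgD.
  apply: cvgB; first by apply: cvgN; apply: cvgM => //; exact: cvg_slow.
  by apply: cvgM; [exact: cvg_phi1'|exact: match0'].
apply: cvgM; first exact: cvg_cst.
apply: cvgB; first exact: cvg_phi.
apply: cvgM; first exact: cvg_cst.
have -> : side R s = side R s * (side R s * side R s) by rewrite /side; case: (s); ring.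
by under eq_cvg do rewrite exprS expr2; do 2?apply: cvgM.
Qed.

Definition stress_trace s i j := eta_ k s * (grad s i j + grad s j i) - (i == j)%:R * pres s.

(** The outer velocity gradient splits into a normal part, the limit of u1' given by first order
    matching, and a tangential part [proj], already present in [stress1]. The two add up to the full
    gradient from either side. *)
Let cvg_stress1 s i j : stress1 i j z @[z --> end_z s] --> stress_trace s i j.
Proof.
have projE a b : proj true a b = proj s a b.
  by rewrite /proj -!(surf_grad_velocity _ _ _ 0).
apply: cvgB; last by apply: cvgM; [exact: cvg_cst|exact: match0].
have -> : eta_ k s = (eta_ k true - eta_ k false) / 2 * side R s
    + (eta_ k true + eta_ k false) / 2.
  by rewrite /side; case: (s); field.
have gradE a b : grad s a b = n b * (\sum_(l < 3) grad s a l * n l) + proj true a b.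
  rewrite projE /proj; under [in RHS]eq_bigr do rewrite mulrC.
  by rewrite addrC subrK.
apply: cvgM.
  by apply: cvgD; [apply: cvgM; [exact: cvg_cst|exact: cvg_phi]|exact: cvg_cst].
rewrite gradE [grad s j i]gradE.
by apply: cvgD; apply: cvgD; try exact: cvg_cst; apply: cvgM; try exact: cvg_cst; exact: match1.
Qed.

(** The function phi0 - phi0^3 / 3 goes from -2/3 to 2/3, so the integral of phi0'^2 is 4 / (3 sqrt
    2). The factor 3 / (2 sqrt 2) in [hat_lambda] is its inverse, and lambda kappa remains. *)
Lemma stress_jump i : \sum_(j < 3) (stress_trace true i j - stress_trace false i j) * n j
  = - lambda k * curvature d q * n i.
Proof.
have limit s : \sum_(j < 3) n j * stress1 i j 0 + n i * (hat_lambda k * profile_term 0)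
    = \sum_(j < 3) n j * stress_trace s i j + n i * (hat_lambda k *
        (curvature d q / Num.sqrt 2 * (side R s - 3^-1 * side R s))).
  apply: (cst_cvg_eq (F := end_z s) (FF := end_z_proper R s)
    (f := fun z => \sum_(j < 3) n j * stress1 i j z + n i * (hat_lambda k * profile_term z))).
    by move=> x w; rewrite !(balance i x) !(balance i w).
  apply: cvgD; last by do 2?(apply: cvgM; first exact: cvg_cst); exact: cvg_profile_term.
  by apply: cvg_sum_ord => j; apply: cvgM; [exact: cvg_cst|exact: cvg_stress1].
under eq_bigr do rewrite mulrC mulrBr.
rewrite sumrB; have := limit false; rewrite (limit true) /side /hat_lambda.
have : Num.sqrt 2 != 0 :> R by rewrite gt_eqF // sqrtr_gt0.
have : Num.sqrt 2 ^+ 2 = 2 :> R by rewrite sqr_sqrtr.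
move: (\sum_(j < 3) n j * stress_trace true i j) (\sum_(j < 3) n j * stress_trace false i j).
move: (curvature d q) (Num.sqrt 2) (n i) (lambda k) => kap b m l P P' b2 b0 e.
have -> : P - P' = (P + m * (3 / (2 * b) * l * (kap / b * (1 - 3^-1 * 1)))
    - m * (3 / (2 * b) * l * (kap / b * (1 - 3^-1 * 1)))) - P' by ring.
rewrite e.
have -> : P' + m * (3 / (2 * b) * l * (kap / b * (-1 - 3^-1 * -1)))
   - m * (3 / (2 * b) * l * (kap / b * (1 - 3^-1 * 1))) - P' = - (2 / (b ^+ 2)) * l * kap * m.
  by field.
by rewrite b2 divff ?pnatr_eq0 // !mulN1r.
Qed.

End StressBalance.

End InnerAnalysis.

(** * The sharp interface system *)

Section LimitSystem.
Context (R : realType) (k : constants R) (hk : constants_pos k) (T : R).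
Variables (Omega : set (vec R)) (Om : bool -> R -> set (vec R)) (Gam : R -> set (vec R)).
Hypothesis hGam : evolving_interface T Omega Om Gam.
Variable (X : outer_coefs R).
Hypothesis X_smooth : forall s c j,
  smooth_upto (sweep T (Om s)) (sweep T (fun t => Om s t `|` Gam t)) (X s c j).
Hypothesis X_sys : forall s, @diffuse_system R (outer (sweep T (Om s))) k (series_of (X s)).
Hypothesis X_phase : forall s q, sweep T (Om s) q -> X s Phi 0%N q = side R s.

(** Since [trace] is a bare [lim], the stress is first replaced by a combination of smooth
    extensions, whose value on the interface is then read off. *)
Lemma phase_stress_trace s i j q : sweep T Gam q ->
  trace Om s (phase_stress k (fun s c => X s c 0%N) s i j) q = stress_trace k Om X q s i j.
Proof.
move=> Gq; rewrite /stress_trace.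
have [hi [shi Xhi dhi thi dthi]] := smooth_traces hGam X_smooth s (Vel i).
have [hj [shj Xhj dhj thj dthj]] := smooth_traces hGam X_smooth s (Vel j).
have [hp [shp Xhp dhp thp dthp]] := smooth_traces hGam X_smooth s Prs.
rewrite dthi // dthj // thp //.
have AG : sweep T (fun t => Om s t `|` Gam t) q by case: Gq => qT Gq2; split=> //; right.
have cd h l : smooth_near (sweep T (fun t => Om s t `|` Gam t)) h -> {for q, continuous (d_x l h)}.
  move=> sh; apply: differentiable_continuous.
  exact: smooth_near_differentiable (smooth_near_deriv _ sh) AG.
have oO : open (sweep T (Om s)) by case: hGam.
apply: (trace_eq hGam Gq (h := fun q => eta_ k s * (d_x j hi q + d_x i hj q) - (i == j)%:R * hp q)).
  move=> q' Oq'; rewrite /phase_stress /stress /strain /=.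
  rewrite /d_x (deriv_eq_on (0, ev R j) oO Xhi Oq') (deriv_eq_on (0, ev R i) oO Xhj Oq').
  rewrite (Xhp _ Oq').
  by rewrite mulrACA divff ?pnatr_eq0 // mul1r.
apply: cvgB; apply: cvgM; try exact: cvg_cst; first by apply: cvgD; exact: cd.
exact: differentiable_continuous (dhp _ Gq).
Qed.

Lemma mix_phase (A : set (stime R)) (c : bool -> R) s q : sweep T (Om s) q ->
  @mix R (classical A 0) c (X s Phi 0%N) q = c s.
Proof.
move=> /X_phase; rewrite /mix /= => ->.
by rewrite /side; case: s; field.
Qed.

(** As phi0 is constantly 1 or -1, both mu0 and the gradient of phi0 vanish, which removes the two
    capillary products at order 0. The coefficients become constants on an open set, so they may be
    replaced under the derivatives too. *)
Lemma sharp_bulk s :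
  @sharp_bulk_system R (classical (sweep T (Om s)) 0) k (fun c => X s c 0%N) s.
Proof.
have oO : open (sweep T (Om s)) by case: hGam.
have [hu hE hB hdB hdJ] := outer_linear_equations (@X_sys s).
split=> //; last first.
  split=> // i q Oq; rewrite (outer_ohm (@X_sys s) i Oq) /=; congr (_ * _).
  exact: (mix_phase (sweep T (Om s)) (sigma_ k) Oq).
move=> i q Oq; have [_] := outer_momentum (@X_sys s) i Oq.
have -> : X s Mu 0%N q = 0.
  rewrite (outer_potential (@X_sys s) Oq) X_phase // /side.
  by case: (s); ring.
have -> : d_x i (X s Phi 0%N) q = 0.
  rewrite /d_x (deriv_eq_on _ oO (@X_phase s) Oq); exact: derive_cst.
rewrite !mix_phase //.
under [X in _ = X + _ + _ + _ -> _]eq_bigr => j _.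
  rewrite /d_x (@deriv_eq_on _ _ _ _ (@stress R (classical (sweep T (Om s)) 0) (fun=> eta_ k s)
    (fun i => X s (Vel i) 0%N) (X s Prs 0%N) i j) _ _ oO _ Oq); last first.
    move=> q' Oq'; rewrite /stress /=; congr (2 * _ * _ - _).
    exact: (mix_phase (sweep T (Om s)) (eta_ k) Oq').
  over.
rewrite mul0r mulr0 addr0 addr0 => e.
rewrite /advect /dot /divT /= !sum3_classical mulrDr mulr_sumr -e; congr (_ + _).
by apply: eq_bigr => j _; rewrite mulrA.
Qed.

End LimitSystem.

Theorem theorem1 (R : realType) (k : constants R) (hk : constants_pos k)
  (T e0 : R) (hT : 0 < T) (he0 : 0 < e0)
  (Omega : set (vec R)) (hOmega : bounded_domain Omega)
  (Om : bool -> R -> set (vec R)) (Gam : R -> set (vec R))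
  (hGam : evolving_interface T Omega Om Gam)
  (w : R -> component -> stime R -> R)
  (hw : solution_family k T e0 Omega Om Gam w)
  (X : outer_coefs R) (hX : outer_expansion k T Om Gam w X)
  (r : remainders R) (Y : inner_coefs R)
  (hY : inner_expansion k T Om Gam w r Y)
  (hXY : matching T Om Gam X Y) :
  sharp_model k T Om Gam (fun s c => X s c 0%N).
Proof.
case: hX => X_smooth _ [X_pos X_neg] X_sys; case: hY => Y_smooth _ Y_sys.
have X_sign s q : sweep T (Om s) q -> 0 < side R s * X s Phi 0%N q.
  by case: s => [/X_pos|/X_neg]; rewrite /side ?mul1r ?mulN1r ?oppr_gt0.
have match0 s c q (Gq : sweep T Gam q) : _ := let: And3 h _ _ := hXY s c q Gq in h.
have match0' s c q (Gq : sweep T Gam q) : _ := let: And3 _ h _ := hXY s c q Gq in h.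
have match1 s c q (Gq : sweep T Gam q) : _ := let: And3 _ _ h := hXY s c q Gq in h.
have X_phase s q : sweep T (Om s) q -> X s Phi 0%N q = side R s.
  exact: (outer_phase_eq hk hOmega hGam X_smooth X_sign X_sys Y_smooth Y_sys match0 match0').
split=> [s|q Gq]; first exact: (sharp_bulk hGam X_sys X_phase).
split=> [i|i|i|i|].
- under eq_bigr => j _ do rewrite /jump !(phase_stress_trace k hGam X_smooth _ i j Gq).
  exact: (stress_jump hk hOmega hGam X_smooth X_sign X_sys Y_smooth Y_sys match0 match0' match1 Gq).
- by rewrite /jump -!(velocity_trace hk hOmega hGam X_smooth X_sign X_sys Y_smooth Y_sys
    match0 match0' Gq _ i 0) subrr.
- by rewrite /jump -!(magnetic_trace hGam Y_smooth Y_sys match0 Gq) subrr.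
- have := electric_trace hGam Y_smooth Y_sys match0 Gq true i.
  rewrite (electric_trace hGam Y_smooth Y_sys match0 Gq false i) /jump.
  move: (trace _ _ _ _) (trace _ _ _ _) (trace _ _ _ _) (trace _ _ _ _) (normal _ _ _)
    (normal _ _ _) => a b c e m l /eqP.
  by rewrite eq_sym -subr_eq0 => /eqP <-; ring.
- split=> [|s].
    under eq_bigr do rewrite /jump mulrC mulrBr.
    rewrite sumrB -(current_trace Y_smooth Y_sys match0 Gq true).
    by rewrite (current_trace Y_smooth Y_sys match0 Gq false) subrr.
  rewrite (interface_velocity_inner hk hOmega hGam X_smooth X_sign X_sys Y_smooth Y_sys
    match0 match0' Gq).
  apply: eq_bigr => i _; rewrite mulrC; congr (_ * _).
  exact: (velocity_trace hk hOmega hGam X_smooth X_sign X_sys Y_smooth Y_sys match0 match0' Gq).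
Qed.
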